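(* Let $D=(-1,1)$ (the case $d=1$). (i) For each $\lambda\in(-1,1)$, the problem $$\gamma_\lambda:=\sup\{(\chi_{D\setminus A},u):\ (u,1)=0,\ A\subseteq D\text{ open}\}$$ (with $\lambda$ fixed and $u=u_{A,\lambda}$) is optimised precisely when either $A=A_{\frac{1-\lambda}{3}}$ or $A=-A_{\frac{1-\lambda}{3}}$. (ii) The problem $$\gamma:=\sup\{(\chi_{D\setminus A},u):\ (u,1)=0,\ A\subseteq D\text{ open},\ \lambda\in(-1,1)\}$$ (with $u=u_{A,\lambda}$) is optimised precisely when either $A=(0,1)$ or $A=(-1,0)$, and has optimal value $1/12$.
   Context: $(\cdot,\cdot)$ is the standard inner product of $L^2(D)$ with respect to Lebesgue measure on $D=(-1,1)$, and $\chi_B$ is the indicator function of $B$. For $A\subseteq D$ open and $\lambda\in(-1,1)$, $u=u_{A,\lambda}$ is the solution of $$0=u''-\lambda-1\ \text{ on }A,\qquad 0=u''-\lambda+1\ \text{ on }D\setminus A,$$ with Dirichlet conditions $u(-1)=u(1)=0$ and with $u$ and $u'$ continuous; that is, $u$ is the unique element of $W^{1,2}_0(D)\cap W^{2,2}(D)$ with $u''=\lambda+\chi_A-\chi_{D\setminus A}$ a.e. on $D$. Let $\psi(x)=\tfrac12(1-x^2)$ and $\varphi(x):=(\chi_{(x,1)},\psi)$ for $x\in D$; for $t\in(0,2/3)$ let $\xi_t\in(-1,1)$ be the unique point with $\varphi(\xi_t)=t$, and set $A_t:=(\xi_t,1)$, $-A_t:=\{-x:x\in A_t\}$.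
   Formalization: Equality of the optimal open set A with the named sets is read up to Lebesgue-null sets; literal equality fails, since e.g. (0,1) minus the point 1/2 is open and, with λ = 0, gives the same u and the same optimal value 1/12. *)

(* Defs.v *)
From HB Require Import structures.
From mathcomp Require Import all_boot all_order all_algebra.
From mathcomp Require Import all_classical all_reals all_analysis.

Set Implicit Arguments.
Unset Strict Implicit.
Unset Printing Implicit Defensive.

Import Order.TTheory GRing.Theory Num.Theory.
Import numFieldNormedType.Exports.

Local Open Scope classical_set_scope.
Local Open Scope ring_scope.

(* Sobolev spaces on an open interval I of the real line, in the
   one-dimensional setting of Brezis, Functional Analysis, Sobolev Spaces and
   PDEs, chapter 8, where the test functions are the C^1 functions with compact
   support in I.  Elements are represented by (Borel) functions R -> R, of which
   only the almost everywhere class on I matters. *)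
Section Sobolev.
Variables (R : realType) (I : set R).

Definition inner (f g : R -> R) : R :=
  \int[lebesgue_measure]_(x in I) (f x * g x).

Definition L2 (f : R -> R) : Prop :=
  (f \_ I) \in Lfun (@lebesgue_measure R) 2%:E.

Definition test_function (phi : R -> R) : Prop :=
  [/\ forall x, derivable phi x 1, continuous (derive1 phi) &
      exists K : set R, [/\ compact K, K `<=` I &
        forall x, ~ K x -> phi x = 0]].

Definition weak_derivative (u g : R -> R) : Prop :=
  [/\ L2 u, L2 g &
      forall phi, test_function phi -> inner u (derive1 phi) = - inner g phi].

Definition second_weak_derivative (u h : R -> R) : Prop :=
  exists2 g, weak_derivative u g & weak_derivative g h.

Definition W22 (u : R -> R) : Prop := exists h, second_weak_derivative u h.

(* The closure of the test functions in W^{1,2}(I), whose squared norm is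
   (v,v) + (v',v'). *)
Definition W120 (u : R -> R) : Prop :=
  exists2 g, weak_derivative u g &
    forall e : R, 0 < e -> exists2 phi, test_function phi &
      inner (u \- phi) (u \- phi) + inner (g \- (derive1 phi)) (g \- (derive1 phi)) < e.

End Sobolev.

Definition null_eq (R : realType) (A B : set R) : Prop :=
  lebesgue_measure (A `+` B) = 0%E.

Section Problem.
Variable R : realType.

Definition D : set R := `]-1, 1[%classic.

Definition solution (A : set R) (lambda : R) (u : R -> R) : Prop :=
  [/\ W120 D u, W22 D u &
      exists2 h, second_weak_derivative D u h &
        \forall x \ae lebesgue_measure,
          D x -> h x = lambda + \1_A x - \1_(D `\` A) x].

Definition feasible (lambda : R) (A : set R) (u : R -> R) : Prop :=
  [/\ open A, A `<=` D, solution A lambda u & inner D u (cst 1) = 0].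

Definition objective (A : set R) (u : R -> R) : \bar R :=
  (inner D (\1_(D `\` A)) u)%:E.

Definition gamma_at (lambda : R) : \bar R :=
  ereal_sup [set v | exists A u, feasible lambda A u /\ objective A u = v].

Definition gamma : \bar R :=
  ereal_sup [set v | exists lambda A u,
    [/\ D lambda, feasible lambda A u & objective A u = v]].

(* Since u = u_{A,lambda} is unique up to null sets, the quantifier over u only
   asks that A be feasible and attain the supremum. *)
Definition optimal_at (lambda : R) (A : set R) : Prop :=
  exists2 u, feasible lambda A u & objective A u = gamma_at lambda.

Definition optimal (A : set R) : Prop :=
  exists lambda u, [/\ D lambda, feasible lambda A u & objective A u = gamma].

Definition psi (x : R) : R := (1 - x ^+ 2) / 2.

Definition varphi (x : R) : R := inner D (\1_(`]x, 1[%classic)) psi.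

Definition xi (t : R) : R := get [set x | D x /\ varphi x = t].

Definition endset (t : R) : set R := `]xi t, 1[%classic.

End Problem.

Arguments D : clear implicits.
Arguments gamma : clear implicits.

(* Main.v *)
(* Write [s = \1_A - \1_(D \ A)], so that [u'' = lambda + s].  If [(u, 1) = 0] the
   objective is half of [E = \int u'^2].  For [f = u + c psi] one has
   [E = - \int s f - 2 c lambda / 3] and [\int f'^2 = E + 2 c^2 / 3], hence [E = 2 E - E]
   is at most [2 \int |f| - \int f'^2] up to an explicit function of [c].  On [0 < f],
   a set of measure [p], completing a square gives
   [2 k \int f^+ - \int_(0 < f) f'^2 <= k^2 p^3 / 12] for every [k], and similarly on
   [f < 0].  Parametrise [lambda = (3 xi - xi^3) / 2], where [xi] is the interface of the
   claimed optimum, and let [-c] be a quantile of [u / psi] such that [0 < f] and [f < 0]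
   have measures at most [1 + xi] and [1 - xi].  A Lagrange multiplier for
   [\int f = 2 c / 3] then yields [E <= (1 - xi^2)^3 / 6], the value of the end set.
   Equality forces [A = {f < 0}] almost everywhere and determines [f'] on both regions
   in such a way that they are intervals, which leaves only the two end sets. *)

Require Import Defs.
From mathcomp Require Import all_boot all_order all_algebra.
From mathcomp Require Import all_classical all_reals all_analysis.
From mathcomp Require Import measurable_realfun ring lra.
Import Order.TTheory GRing.Theory Num.Theory.
Import numFieldNormedType.Exports.
Local Open Scope classical_set_scope.
Local Open Scope ring_scope.

Set Implicit Arguments.
Unset Strict Implicit.
Unset Printing Implicit Defensive.

(** * Lipschitz primitives *)

Section Development.
Context {R : realType}.
Notation mu := (@lebesgue_measure R).
Notation E := (`[(-1 : R), 1]%classic).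
Implicit Types (f g F G : R -> R) (x y z : R).

(** Among functions vanishing at the ends of an interval of length [p], [2 k \int f - \int f'^2] is
    largest for the parabola with [f'' = - k], where it is [k^2 p^3 / 12]; cubes being
    superadditive, splitting a set of measure [p] into components only lowers this. The estimate
    needs the measures of both sign sets, about which [u] says nothing. The free parameter [c]
    supplies them: as [psi > 0], the sign sets of [f] are level sets of [u / psi].

    The constants come from the end set, where [f] consists of two parabolas, on lengths [1 + xi]
    and [1 - xi], with [f'' = - (1 - k)] and [f'' = 1 + k], [k] being the multiplier. Equal slopes
    at the interface mean [(1 - k) (1 + xi) = (1 + k) (1 - xi)], so [k = xi]. Then
    [\int f = 2 c / 3] gives [c = xi (1 - xi^2) / 2], and [f'' = lambda - 1 - c] on the first piece
    gives [lambda = k + c], which is the cubic in [xi].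

    For a general [A] the quantile [c] is not under control. Once [k] is optimised, however, the
    bound is a concave quadratic in [c] whose top is at the value above, so any other quantile only
    improves the estimate. *)

Definition bm f : Prop :=
  measurable_fun E f /\ exists M : R, forall x, -1 <= x <= 1 -> `|f x| <= M.

(* Half-open, so that adjacent intervals concatenate exactly. *)
Definition Int x y f : R := \int[mu]_(t in `]x, y]) f t.

Lemma EE x : E x = (-1 <= x <= 1) :> Prop.
Proof. by rewrite /= in_itv. Qed.

Lemma bm_ext f g : bm f -> (forall x, -1 <= x <= 1 -> f x = g x) -> bm g.
Proof.
move=> [mf [M Mf]] fg; split.
  apply: eq_measurable_fun mf => x.
  by rewrite inE EE; exact: fg.
by exists M => x xE; rewrite -fg// Mf.
Qed.

Lemma bm_cst (c : R) : bm (fun=> c).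
Proof. by split; [exact: measurable_cst | exists `|c|]. Qed.

Lemma bm_id : bm (fun x => x).
Proof.
split; first exact: measurable_id.
by exists 1 => x; rewrite ler_norml.
Qed.

Lemma bmD f g : bm f -> bm g -> bm (fun x => f x + g x).
Proof.
move=> [mf [M Mf]] [mg [N Ng]]; split; first exact: measurable_funD.
exists (M + N) => x xE; apply: le_trans (ler_normD _ _) _.
by rewrite lerD ?Mf ?Ng.
Qed.

Lemma bmN f : bm f -> bm (fun x => - f x).
Proof.
move=> [mf [M Mf]]; split; first exact: measurableT_comp.
by exists M => x xE; rewrite normrN Mf.
Qed.

Lemma bmM f g : bm f -> bm g -> bm (fun x => f x * g x).
Proof.
move=> [mf [M Mf]] [mg [N Ng]]; split; first exact: measurable_funM.
exists (M * N) => x xE; rewrite normrM.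
by rewrite ler_pM ?Mf ?Ng.
Qed.

Lemma bmX f n : bm f -> bm (fun x => f x ^+ n).
Proof.
move=> bf; elim: n => [|n IH]; first exact: bm_cst.
by under eq_fun do rewrite exprS; exact: bmM.
Qed.

Lemma bm_norm f : bm f -> bm (fun x => `|f x|).
Proof.
move=> [mf [M Mf]]; split; first exact: measurableT_comp.
by exists M => x xE; rewrite normr_id Mf.
Qed.

Lemma bm_max f g : bm f -> bm g -> bm (fun x => Num.max (f x) (g x)).
Proof.
move=> [mf [M Mf]] [mg [N Ng]]; split; first exact: measurable_maxr.
exists (Num.max M N) => x xE; case: (leP (f x) (g x)) => _.
  by rewrite (le_trans (Ng _ xE))// le_max lexx orbT.
by rewrite (le_trans (Mf _ xE))// le_max lexx.
Qed.

Ltac bmt := solve [repeat first [assumption | apply: bm_cst | apply: bm_id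
  | apply: bmD | apply: bmN | apply: bmM | apply: bmX | apply: bm_norm
  | apply: bm_max]].

Definition ind f x : R := if 0 < f x then 1 else 0.

Lemma bm_ind f : bm f -> bm (ind f).
Proof.
move=> [mf _]; split.
  rewrite /ind; apply: measurable_fun_if => //.
  exact: measurable_fun_ltr.
by exists 1 => x _; rewrite /ind; case: ifP => _; rewrite ?normr1 ?normr0.
Qed.

Lemma sub_E x y : -1 <= x -> y <= 1 -> `]x, y]%classic `<=` E.
Proof.
move=> x1 y1 t /=; rewrite !in_itv/= => /andP[xt ty]; apply/andP; split; lra.
Qed.

Lemma bm_integrable f x y : -1 <= x -> y <= 1 -> bm f ->
  mu.-integrable `]x, y] (EFin \o f).
Proof.
move=> x1 y1 [mf [M Mf]].
apply: measurable_bounded_integrable => //.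
- by rewrite /= lebesgue_measure_itv/=; case: ifP => _; rewrite ?ltry// -EFinD ltry.
- by apply: measurable_funS mf => //; exact: sub_E.
- exists M; split; rewrite ?num_real // => N MN t /= xy /=.
  by rewrite (le_trans (Mf _ _)) ?(ltW MN)// -EE; exact: (sub_E x1 y1).
Qed.

Lemma Int_ext f g x y : -1 <= x -> y <= 1 ->
  (forall t, x < t <= y -> f t = g t) -> Int x y f = Int x y g.
Proof.
by move=> x1 y1 fg; apply: eq_Rintegral => t; rewrite inE/= in_itv/=; exact: fg.
Qed.

Lemma IntD f g x y : -1 <= x -> y <= 1 -> bm f -> bm g ->
  Int x y (fun t => f t + g t) = Int x y f + Int x y g.
Proof. by move=> *; rewrite /Int RintegralD//; exact: bm_integrable. Qed.

Lemma IntZ f c x y : -1 <= x -> y <= 1 -> bm f ->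
  Int x y (fun t => c * f t) = c * Int x y f.
Proof. by move=> *; rewrite /Int RintegralZl//; exact: bm_integrable. Qed.

Lemma IntN f x y : -1 <= x -> y <= 1 -> bm f ->
  Int x y (fun t => - f t) = - Int x y f.
Proof.
move=> *; rewrite -mulN1r -IntZ//.
by congr Int; apply/funext => t; rewrite mulN1r.
Qed.

Lemma Int_cst c x y : x <= y -> Int x y (fun=> c) = c * (y - x).
Proof.
move=> xy; rewrite /Int Rintegral_cst//= lebesgue_measure_itv/=.
rewrite lte_fin; move: xy; rewrite le_eqVlt => /predU1P[->|xy].
  by rewrite ltxx subrr.
by rewrite xy -EFinD.
Qed.

Lemma Int_le f g x y : -1 <= x -> y <= 1 -> bm f -> bm g ->
  (forall t, x < t <= y -> f t <= g t) -> Int x y f <= Int x y g.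
Proof.
move=> x1 y1 bf bg fg; apply: le_Rintegral => //; try exact: bm_integrable.

Qed.

Lemma Int_ge0 f x y : (forall t, x < t <= y -> 0 <= f t) -> 0 <= Int x y f.
Proof.
by move=> f0; apply: Rintegral_ge0 => t; rewrite /= in_itv; exact: f0.
Qed.

Lemma Int_norm f M x y : -1 <= x -> x <= y -> y <= 1 -> bm f ->
  (forall t, x < t <= y -> `|f t| <= M) -> `|Int x y f| <= M * (y - x).
Proof.
move=> x1 xy y1 bf Mf; rewrite -(Int_cst M xy).
apply: (le_trans (@le_normr_Rintegral _ _ _ mu _ _ _ _)) => //.
  exact: bm_integrable.
apply: Int_le => //; [exact: bm_norm | exact: bm_cst].
Qed.

Lemma Int_cat f x y z : -1 <= x -> x <= y -> y <= z -> z <= 1 -> bm f ->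
  Int x z f = Int x y f + Int y z f.
Proof.
move=> x1 xy yz z1 bf; rewrite /Int.
rewrite -(@Rintegral_itvB _ f (BRight x) (BRight z) y) ?bnd_simp//.
  by rewrite addrC subrK.
exact: bm_integrable.
Qed.

Lemma Int_xx f x : Int x x f = 0.
Proof. by rewrite /Int set_itv_ge ?bnd_simp ?ltxx// Rintegral_set0. Qed.

(* Quadratic increments force a function to be constant: all the product and
   chain rules for [prim] below are obtained from this. *)
Lemma quad_cst (P : R -> R) (C : R) :
  (forall x y, -1 <= x -> x <= y -> y <= 1 -> `|P y - P x| <= C * (y - x) ^+ 2) ->
  forall x, -1 <= x <= 1 -> P x = P (-1).
Proof.
move=> PC x /andP[x1 x2].
have C0 : 0 <= C by have := PC (-1) 1; have := normr_ge0 (P 1 - P (-1)); nra.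
(* Cutting [[-1, x]] into [n + 1] equal steps bounds the total increment by [C (x + 1)^2 / (n + 1)],
   which tends to 0. *)
have key (n : nat) : `|P x - P (-1)| * n.+1%:R <= C * (x + 1) ^+ 2.
  pose d := (x + 1) / n.+1%:R.
  have n0 : 0 < n.+1%:R :> R by rewrite ltr0n.
  have d0 : 0 <= d by rewrite divr_ge0// ?ler0n//; lra.
  have dn : d * n.+1%:R = x + 1 by rewrite mulfVK// gt_eqF.
  have H k : (k <= n.+1)%N -> `|P (-1 + d * k%:R) - P (-1)| <= C * d ^+ 2 * k%:R.
    elim: k => [|k IH] kn; first by rewrite !mulr0 addr0 subrr normr0.
    have kn' : d * k.+1%:R <= x + 1 by rewrite -dn ler_wpM2l// ler_nat.
    have dk : 0 <= d * k%:R by rewrite mulr_ge0// ler0n.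
    have e1 : d * k.+1%:R = d * k%:R + d by rewrite -natr1 mulrDr mulr1.
    have h1 := IH (ltnW kn).
    have := PC (-1 + d * k%:R) (-1 + d * k.+1%:R).
    have -> : -1 + d * k.+1%:R - (-1 + d * k%:R) = d by rewrite e1; ring.
    have -> : C * d ^+ 2 * k.+1%:R = C * d ^+ 2 * k%:R + C * d ^+ 2.
      by rewrite -natr1 mulrDr mulr1.
    move=> h2; have {}h2 := h2 ltac:(lra) ltac:(lra) ltac:(lra).
    have := ler_normD (P (-1 + d * k.+1%:R) - P (-1 + d * k%:R)) (P (-1 + d * k%:R) - P (-1)).
    rewrite addrA subrK; lra.
  have := H n.+1 (leqnn _); rewrite dn addrA addrAC addNr add0r => h.
  have : C * d ^+ 2 * n.+1%:R * n.+1%:R = C * (x + 1) ^+ 2.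
    by rewrite -dn; ring.
  by move=> <-; rewrite ler_wpM2r ?ler0n.
apply/eqP; rewrite -subr_eq0 -normr_eq0 eq_le normr_ge0 andbT leNgt.
apply/negP => p0.
have := archi_boundP (x := C * (x + 1) ^+ 2 / `|P x - P (-1)|).
set n := Num.bound _ => h.
have {}h := h ltac:(by rewrite divr_ge0// mulr_ge0// sqr_ge0).
have := key n; move: h; rewrite ltr_pdivrMr// -natr1 mulrDr mulr1 [n%:R * _]mulrC; lra.
Qed.

(** Differentiation in integrated form: [f] may jump, as [u''] does at the boundary of [A], and
    every rule below becomes a statement about integrals over short intervals. *)
Definition prim f F : Prop :=
  bm f /\ forall x y, -1 <= x -> x <= y -> y <= 1 -> F y - F x = Int x y f.

Lemma prim_ext f g F G : prim f F -> (forall x, -1 <= x <= 1 -> f x = g x) ->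
  (forall x, -1 <= x <= 1 -> F x = G x) -> prim g G.
Proof.
move=> [bf pF] fg FG; split; first exact: bm_ext fg.
move=> x y x1 xy y1; rewrite -!FG ?pF; try lra.
by apply: Int_ext => // t /andP[? ?]; apply: fg; lra.
Qed.

Lemma prim_lip f F : prim f F -> exists2 M : R, 0 <= M &
  (forall x, -1 <= x <= 1 -> `|f x| <= M) /\
  (forall x y, -1 <= x -> x <= y -> y <= 1 -> `|F y - F x| <= M * (y - x)).
Proof.
move=> [bf pF]; have [_ [M Mf]] := bf.
have M0 : 0 <= M by apply: le_trans (Mf 0 _); rewrite ?normr_ge0//; lra.
exists M => //; split=> // x y x1 xy y1; rewrite pF//.
by apply: Int_norm => // t /andP[? ?]; apply: Mf; lra.
Qed.

Lemma prim_bm f F : prim f F -> bm F.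
Proof.
move=> pF; have [M M0 [_ MF]] := prim_lip pF.
have lip x y : -1 <= x <= 1 -> -1 <= y <= 1 -> `|F x - F y| <= M * `|x - y|.
  move=> /andP[? ?] /andP[? ?]; case: (leP x y) => xy.
    by rewrite distrC [`|x - y|]distrC [`|y - x|]ger0_norm ?MF//; lra.
  by rewrite [`|x - y|]ger0_norm ?MF//; lra.
split; last first.
  exists (`|F 0| + M) => x xE.
  have := ler_normD (F x - F 0) (F 0); rewrite subrK => /le_trans; apply.
  rewrite addrC lerD2l; apply: le_trans (lip _ _ _ _) _ => //; first lra.
  by rewrite subr0 ler_piMr// ler_norml; lra.
apply: subspace_continuous_measurable_fun => //.
apply/subspace_continuousP => x xE.
apply/cvgrPdist_le => e e0; rewrite near_withinE; near=> y => yE.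
apply: (le_trans (lip _ _ _ _)).
- by rewrite -EE.
- by rewrite -EE.
apply: (@le_trans _ _ ((M + 1) * `|x - y|)); first by rewrite ler_wpM2r//; lra.
rewrite mulrC -ler_pdivlMr; last lra.
near: y; apply/nbhs_ballP; exists (e / (M + 1)) => /=.
  by rewrite divr_gt0//; lra.
by move=> y /= /ltW.
Unshelve. all: by end_near. Qed.

Lemma prim_cst c : prim (fun=> 0) (fun=> c).
Proof.
split; first exact: bm_cst.
by move=> x y _ xy _; rewrite Int_cst// mul0r subrr.
Qed.

Lemma prim_id : prim (fun=> 1) (fun x => x).
Proof.
split; first exact: bm_cst.
by move=> x y _ xy _; rewrite Int_cst// mul1r.
Qed.

Lemma primD f g F G : prim f F -> prim g G ->
  prim (fun x => f x + g x) (fun x => F x + G x).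
Proof.
move=> [bf pF] [bg pG]; split; first exact: bmD.
by move=> x y *; rewrite IntD// -pF// -pG//; ring.
Qed.

Lemma primZ c f F : prim f F -> prim (fun x => c * f x) (fun x => c * F x).
Proof.
move=> [bf pF]; split; first by apply: bmM => //; exact: bm_cst.
by move=> x y *; rewrite IntZ// -pF//; ring.
Qed.

Lemma primI c f : bm f -> prim f (fun x => c + Int (-1) x f).
Proof.
move=> bf; split=> // x y x1 xy y1.
by rewrite (@Int_cat f (-1) x y)//; ring.
Qed.

Lemma prim_int f F : prim f F -> Int (-1) 1 f = F 1 - F (-1).
Proof. by move=> [_ pF]; rewrite pF//; lra. Qed.

(** [F] minus the integral of [f] has quadratic increments, hence is constant. A calculus rule is
    thereby reduced to a second-order error estimate. *)
Lemma prim_quad f F (C : R) : bm f ->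
  (forall x y, -1 <= x -> x <= y -> y <= 1 ->
     `|F y - F x - Int x y f| <= C * (y - x) ^+ 2) -> prim f F.
Proof.
move=> bf H.
have K := @quad_cst (fun x => F x - Int (-1) x f) C.
have {}K : forall x, -1 <= x <= 1 -> F x - Int (-1) x f = F (-1) - Int (-1) (-1) f.
  apply: K => x y x1 xy y1; apply: le_trans (H _ _ x1 xy y1).
  by rewrite (@Int_cat f (-1) x y)// le_eqVlt; apply/orP; left; apply/eqP; congr (`|_|); ring.
split=> // x y x1 xy y1.
have := K x; have := K y; rewrite (@Int_cat f (-1) x y)// => h1 h2.
have := h1 ltac:(lra); have := h2 ltac:(lra); lra.
Qed.

Lemma primM f g F G : prim f F -> prim g G ->
  prim (fun x => f x * G x + F x * g x) (fun x => F x * G x).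
Proof.
move=> pF pG.
have bF := prim_bm pF; have bG := prim_bm pG.
have [M M0 [Mf MF]] := prim_lip pF; have [N N0 [Ng NG]] := prim_lip pG.
have [bf pf] := pF; have [bg pg] := pG.
apply: (@prim_quad _ _ (M * N + M * N)).
  by apply: bmD; apply: bmM.
move=> x y x1 xy y1.
have bc : forall c, bm (fun=> c) by exact: bm_cst.
(* The error is rewritten so that each bounded derivative is multiplied by an increment of the other
   factor; the integrand is then of order [y - x]. *)
have -> : F y * G y - F x * G x - Int x y (fun t => f t * G t + F t * g t) =
    Int x y (fun t => f t * (G y - G t) + (F x - F t) * g t).
  have -> : Int x y (fun t => f t * (G y - G t) + (F x - F t) * g t) =
      Int x y (fun t => (G y * f t + F x * g t) + (- (f t * G t + F t * g t))).
    by congr Int; apply/funext => t; ring.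
  rewrite [RHS]IntD; [|by []|by []|bmt|bmt].
  rewrite IntN; [|by []|by []|bmt].
  by rewrite [in RHS]IntD ?IntZ -?pf -?pg//; [ring|bmt|bmt].
have -> : (M * N + M * N) * (y - x) ^+ 2 = (M * N * (y - x) + M * N * (y - x)) * (y - x) by ring.
apply: Int_norm => //.
  by apply: bmD; apply: bmM => //; apply: bmD => //; apply: bmN.
move=> t /andP[xt ty]; apply: le_trans (ler_normD _ _) _; rewrite !normrM.
apply: lerD.
  rewrite -mulrA; apply: ler_pM => //; first by apply: Mf; lra.
  apply: le_trans (NG t y _ _ _) _; try lra.
  by rewrite ler_wpM2l//; lra.
rewrite mulrAC; apply: ler_pM => //; last by apply: Ng; lra.
rewrite distrC; apply: le_trans (MF x t _ _ _) _; try lra.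
by rewrite ler_wpM2l//; lra.
Qed.

(** * Positive parts *)

Definition pos f x : R := Num.max (f x) 0.

Lemma bm_pos f : bm f -> bm (pos f).
Proof. by move=> bf; apply: bm_max => //; exact: bm_cst. Qed.

(** Squaring smooths the kink at 0: the derivative [2 max(t, 0)] is 2-Lipschitz, so the first-order
    Taylor remainder is at most [(b - a)^2]. *)
Lemma pos_sqr_quad (a b : R) :
  `|Num.max b 0 ^+ 2 - Num.max a 0 ^+ 2 - 2 * Num.max a 0 * (b - a)| <= (b - a) ^+ 2.
Proof.
have h := sqr_ge0 (b - a); have h1 := sqr_ge0 a; have h2 := sqr_ge0 b.
rewrite ler_norml.
case: (leP a 0) => ha; case: (leP b 0) => hb; apply/andP; split;
  try have := mulr_ge0_le0 (ltW ha) hb; try have := mulr_ge0_le0 (ltW hb) ha;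
  lra.
Qed.

Lemma prim_pos_sqr f F : prim f F ->
  prim (fun x => 2 * pos F x * f x) (fun x => pos F x ^+ 2).
Proof.
move=> pF; have bF := prim_bm pF; have [M M0 [Mf MF]] := prim_lip pF.
have [bf pf] := pF.
have bc : forall c, bm (fun=> c) by exact: bm_cst.
have bp := bm_pos bF.
apply: (@prim_quad _ _ (3 * M ^+ 2)).
  by apply: bmM => //; apply: bmM.
move=> x y x1 xy y1.
have -> : pos F y ^+ 2 - pos F x ^+ 2 - Int x y (fun t => 2 * pos F t * f t) =
   (pos F y ^+ 2 - pos F x ^+ 2 - 2 * pos F x * (F y - F x)) +
   Int x y (fun t => 2 * (pos F x - pos F t) * f t).
  have -> : Int x y (fun t => 2 * (pos F x - pos F t) * f t) =
      Int x y (fun t => 2 * pos F x * f t + - (2 * pos F t * f t)).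
    by congr Int; apply/funext => t; ring.
  rewrite [in RHS]IntD; [|by []|by []|bmt|bmt].
  rewrite [in RHS]IntN; [|by []|by []|bmt].
  by rewrite IntZ// -pf//; ring.
apply: le_trans (ler_normD _ _) _.
have -> : 3 * M ^+ 2 * (y - x) ^+ 2 = (M * (y - x)) ^+ 2 +
    (2 * (M * (y - x)) * M) * (y - x) by ring.
have lp a b : `|Num.max a 0 - Num.max b 0| <= `|a - b| :> R.
  by case: (leP a 0); case: (leP b 0) => ? ?; rewrite ?subrr ?normr0//
    ?sub0r ?subr0 ?normrN ler_norml; have := ler_norm (a - b); have := ler_norm (b - a);
    rewrite (distrC b a); lra.
apply: lerD.
  apply: (@le_trans _ _ (`|F y - F x| ^+ 2)).
    by rewrite real_normK ?num_real// pos_sqr_quad.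
  by rewrite lerXn2r ?nnegrE ?MF// mulr_ge0//; lra.
apply: Int_norm => //.
  by apply: bmM => //; apply: bmM => //; apply: bmD => //; exact: bmN.
move=> t /andP[xt ty]; rewrite !normrM ger0_norm//; apply: ler_pM => //.
  rewrite ler_wpM2l//; apply: le_trans (lp _ _) _.
  rewrite distrC; apply: le_trans (MF x t _ _ _) _; try lra.
by rewrite ler_wpM2l//; lra.
by apply: Mf; lra.
Qed.

Lemma ae_imp (P Q : R -> Prop) : (forall x, P x -> Q x) ->
  (\forall x \ae mu, P x) -> \forall x \ae mu, Q x.
Proof. by move=> PQ; exact: (@filterS _ _ (ae_filter_ringOfSetsType mu)). Qed.

Lemma ae_imp2 (P Q S : R -> Prop) : (forall x, P x -> Q x -> S x) ->
  (\forall x \ae mu, P x) -> (\forall x \ae mu, Q x) -> \forall x \ae mu, S x.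
Proof. by move=> PQS; exact: (@filterS2 _ _ (ae_filter_ringOfSetsType mu)). Qed.

Lemma ae_neq y : \forall t \ae mu, t != y.
Proof.
exists [set y]; split => //; first by rewrite lebesgue_measure_set1.
by move=> t /= /negP; rewrite negbK => /eqP.
Qed.

(** Convergence is asked for on the open interval only, because the later uses degenerate at the
    ends: [psi] and the plateau functions vanish at -1 and 1. *)
Lemma Int_cvg (f_ : nat -> R -> R) f M x y : -1 <= x -> y <= 1 -> bm f ->
  (forall n, bm (f_ n)) ->
  (forall n t, -1 <= t <= 1 -> `|f_ n t| <= M) ->
  (forall t, -1 < t < 1 -> f_ ^~ t @ \oo --> f t) ->
  Int x y (f_ n) @[n --> \oo] --> Int x y f.
Proof.
move=> x1 y1 bf bf_ Mf cvf.
have bi g : bm g -> mu.-integrable `]x, y] (EFin \o g) by exact: bm_integrable.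
have tE t : `]x, y]%classic t -> -1 <= t <= 1.
  by move=> txy; rewrite -EE; exact: (sub_E x1 y1).
have [] := @dominated_convergence _ _ _ mu `]x, y]%classic _
  (fun n => EFin \o f_ n) (EFin \o f) (EFin \o (fun=> M)).
- by [].
- by move=> n; have /integrableP[] := bi _ (bf_ n).
- by have /integrableP[] := bi _ bf.
- apply: ae_imp (ae_neq 1) => t t1; rewrite /= in_itv/= => /andP[xt ty].
  apply: cvg_EFin; first exact: nearW.
  by apply: cvf; rewrite (le_lt_trans x1 xt) lt_neqAle t1 (le_trans ty).
- by apply: bi; exact: bm_cst.
- by apply: aeW => t n /tE tI /=; rewrite lee_fin Mf.
move=> _ _ h; rewrite /Int /Rintegral; apply: fine_cvg.
rewrite fineK//; exact: integrable_fin_num (bi _ bf).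
Qed.

(** The kink of the positive part defeats a quadratic estimate, so [pos F] is reached as the limit
    of [((F^+)^2 - ((F - e)^+)^2) / (2 e)]. These have derivatives given by [prim_pos_sqr], which
    are dominated by a bound of [f] and converge pointwise to [ind F * f]. *)
Lemma prim_pos f F : prim f F -> prim (fun x => ind F x * f x) (pos F).
Proof.
move=> pF; have bF := prim_bm pF; have [M M0 [Mf MF]] := prim_lip pF.
have [bf pf] := pF; have bi := bm_ind bF.
have [e [e0 ecvg]] : exists e : nat -> R, (forall n, 0 < e n) /\ e n @[n --> \oo] --> 0.
  exists (fun n => n.+1%:R^-1); split; last exact: cvg_harmonic.
  by move=> n; rewrite invr_gt0 ltr0n.
pose Fe n x := F x + - e n.
have pFe n : prim f (Fe n).
  by apply: prim_ext (primD pF (prim_cst (- e n))) _ _ => x _ //; rewrite addr0.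
pose g n x := (pos F x - pos (Fe n) x) / e n * f x.
pose K n x := (pos F x ^+ 2 - pos (Fe n) x ^+ 2) / (2 * e n).
have pK n : prim (g n) (K n).
  have p1 := primZ (2 * e n)^-1 (primD (prim_pos_sqr pF) (primZ (-1) (prim_pos_sqr (pFe n)))).
  apply: prim_ext p1 _ _ => x _; rewrite /g /K; first by field; rewrite gt_eqF.
  by field; rewrite gt_eqF.
have bnd n x : `|(pos F x - pos (Fe n) x) / e n| <= 1.
  rewrite ler_norml ler_pdivlMr// ler_pdivrMr// /pos /Fe; have := e0 n.
  by case: (leP (F x) 0); case: (leP (F x + - e n) 0) => ? ? ?; lra.
have small x : 0 < F x -> \forall n \near \oo, e n <= F x.
  move=> Fx.
  move/cvgrPdist_le : ecvg => /(_ _ Fx); apply: filterS => n.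
  by rewrite sub0r normrN (ger0_norm (ltW (e0 n))).
split; first exact: bmM.
move=> x y x1 xy y1.
have c1 : Int x y (g n) @[n --> \oo] --> Int x y (fun t => ind F t * f t).
  apply: (@Int_cvg _ _ M) => //.
  - exact: bmM.
  - by move=> n; have [] := pK n.
  - move=> n t tI; rewrite normrM -[M]mul1r; apply: ler_pM => //; exact: Mf.
  - move=> t _; apply: cvgMl; rewrite /ind; case: ifPn => Ft.
      apply: cvg_near_cst; apply: filterS (small _ Ft) => n en.
      rewrite /pos /Fe (max_l (ltW Ft)) max_l; last lra.
      by rewrite opprD opprK addrA subrr add0r divff// gt_eqF.
    apply: cvg_near_cst; apply: nearW => n; move: Ft; rewrite -leNgt => Ft.
    by rewrite /pos /Fe !max_r ?subrr ?mul0r//; have := e0 n; lra.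
have cK t : K ^~ t @ \oo --> pos F t.
  have Kb n : `|pos F t - K n t| <= e n.
    have kE : K n t * (2 * e n) = pos F t ^+ 2 - pos (Fe n) t ^+ 2.
      by rewrite /K divfK// mulf_neq0// gt_eqF.
    have := e0 n; move: kE; rewrite /pos /Fe ler_norml.
    move: (K n t) (e n) (F t) => k e' a kE e'0; apply/andP.
    case: (leP a 0) kE => ha; case: (leP (a + - e') 0) => hb kE.
    - have k0 : k = 0 by nra.
      split; lra.
    - lra.
    - split; nra.
    - have kE' : k = a - e' / 2 by nra.
      split; lra.
  apply/cvgrPdist_le => d d0.
  move/cvgrPdist_le : ecvg => /(_ _ d0); apply: filterS => n.
  by rewrite sub0r normrN (ger0_norm (ltW (e0 n))) => /(le_trans (Kb n)).
have c2 : K n y - K n x @[n --> \oo] --> pos F y - pos F x.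
  by apply: cvgB.
apply: (cvg_unique _ c2).
  exact: Rhausdorff.
apply: cvg_trans c1; apply: near_eq_cvg; apply: nearW => n.
by have [_ ->] := pK n.
Qed.

(** * The energy identity *)

Notation I := (Int (-1) 1).

Lemma ID f g : bm f -> bm g -> I (fun t => f t + g t) = I f + I g.
Proof. by move=> *; rewrite IntD//; lra. Qed.

Lemma IZ c f : bm f -> I (fun t => c * f t) = c * I f.
Proof. by move=> *; rewrite IntZ//; lra. Qed.

Lemma IN f : bm f -> I (fun t => - f t) = - I f.
Proof. by move=> *; rewrite IntN//; lra. Qed.

Lemma I_ext f g : (forall t, -1 < t <= 1 -> f t = g t) -> I f = I g.
Proof. by move=> fg; apply: Int_ext; rewrite ?lexx. Qed.

Lemma I_ge0 f : (forall t, -1 < t <= 1 -> 0 <= f t) -> 0 <= I f.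
Proof. exact: Int_ge0. Qed.

Lemma I_le f g : bm f -> bm g -> (forall t, -1 < t <= 1 -> f t <= g t) -> I f <= I g.
Proof. by move=> ? ?; apply: Int_le; rewrite ?lexx. Qed.

Lemma prim_sub_cst c f F : prim f F -> prim f (fun x => F x - c).
Proof.
by move=> pF; apply: prim_ext (primD pF (prim_cst (- c))) _ _ => // x _; rewrite addr0.
Qed.

Lemma I_eq0 f : bm f -> (forall x, -1 < x <= 1 -> 0 <= f x) -> I f = 0 ->
  \forall x \ae mu, -1 < x <= 1 -> f x = 0.
Proof.
move=> bf f0 I0.
have fi := @bm_integrable f (-1) 1 (lexx _) (lexx _) bf.
have mf : measurable_fun `](-1 : R), 1] (EFin \o f).
  by have /integrableP[] := fi.
have h : (\int[mu]_(x in `](-1)%R, 1%R]) `|(EFin \o f) x| = 0)%E.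
  transitivity (\int[mu]_(x in `](-1)%R, 1%R]) (f x)%:E)%E.
    by apply: eq_integral => x; rewrite inE/= in_itv/= => xI; rewrite ger0_norm// f0.
  rewrite -[LHS]fineK; first by rewrite -[fine _]/(I f) I0.
  exact: integrable_fin_num fi.
have /(ae_eq_integral_abs mu _ mf) := h.
move=> /(_ (measurable_itv _)); apply: filterS => x /= fx xI.
by have := fx; rewrite in_itv/= xI => /(_ isT) [].
Qed.

(** * The sharp estimate on a positivity set *)

Section Arc.
Variables (g F : R -> R).
Hypotheses (pF : prim g F) (Fl : F (-1) = 0) (Fr : F 1 = 0).
Let p := I (ind F).

(** The completed square. It vanishes on [0 < F] when [F'] is [- k (m - p / 2)], the slope of the
    extremal parabola written in terms of the mass [m] of [0 < F] already passed instead of the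
    position. *)
Definition arc k x := ind F x * (g x + k * (Int (-1) x (ind F) - p / 2)) ^+ 2.

Lemma bm_mass : bm (fun x => Int (-1) x (ind F) - p / 2).
Proof.
have bi := bm_ind (prim_bm pF).
have := prim_bm (prim_sub_cst (p / 2) (primI 0 bi)).
by move=> /bm_ext; apply=> x _; rewrite add0r.
Qed.

Lemma bm_arc k : bm (arc k).
Proof.
have bi := bm_ind (prim_bm pF); have bM := bm_mass; have [bg _] := pF.
by rewrite /arc; bmt.
Qed.

(* With [m] the mass of [0 < F] to the left of a point, integrating [(m - p/2) F^+]
   by parts turns [\int F^+] into [- \int_(0 < F) (m - p/2) F'], so no decomposition
   of [0 < F] into intervals is required. *)
Lemma arc_identity k :
  I (arc k) = I (fun x => ind F x * g x ^+ 2) - 2 * k * I (pos F) + k ^+ 2 * p ^+ 3 / 12.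
Proof.
have bi := bm_ind (prim_bm pF); have [bg _] := pF.
have bp := bm_pos (prim_bm pF).
have bM := bm_mass.
set m := fun x => Int (-1) x (ind F) - p / 2 in bM *.
have pm : prim (ind F) m.
  apply: prim_ext (prim_sub_cst (p / 2) (primI 0 bi)) _ _ => // x _.
  by rewrite add0r.
have m1 : m 1 = p / 2 by rewrite /m -/p; field.
have m0 : m (-1) = - (p / 2) by rewrite /m Int_xx; ring.
have h1 : I (pos F) + I (fun x => ind F x * g x * m x) = 0.
  rewrite -ID//; last by bmt.
  have := prim_int (primM pm (prim_pos pF)).
  rewrite /pos Fl Fr !max_r// !mulr0 subrr => h; apply: etrans h.
  apply: I_ext => t _; by rewrite /ind /pos; case: ltP => Ft; ring.
(* [m^3 / 3] is a primitive of the integrand and [m] runs from [- p / 2] to [p / 2]; this is the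
   origin of the 12. *)
have h2 : I (fun x => ind F x * m x ^+ 2) = p ^+ 3 / 12.
  have := prim_int (primM pm (primM pm pm)).
  have -> : I (fun x => ind F x * (m x * m x) + m x * (ind F x * m x + m x * ind F x)) =
     I (fun x => 3 * (ind F x * m x ^+ 2)).
    by apply: I_ext => t _; ring.
  rewrite IZ; last by bmt.
  rewrite m1 m0 => h; apply: (@mulfI _ 3); first by rewrite pnatr_eq0.
  by rewrite h; field.
transitivity (I (fun x => ind F x * g x ^+ 2 +
   (2 * k * (ind F x * g x * m x) + k ^+ 2 * (ind F x * m x ^+ 2)))).
  by apply: I_ext => t _; rewrite /arc -/(m t); ring.
rewrite ID; [|bmt|bmt]; rewrite ID; [|bmt|bmt].
rewrite !IZ; [|bmt|bmt].
rewrite h2 -addrA; congr (_ + _).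
have -> : I (fun x => ind F x * g x * m x) = - I (pos F) by lra.
by field.
Qed.

End Arc.

(* The classical form of [u_(A,lambda)] when [(u, 1) = 0]: [U] is [u] and [G] is [u']. *)
Definition is_state lam s (G U : R -> R) :=
  [/\ bm s, forall x, -1 < x < 1 -> `|s x| = 1, prim (fun x => lam + s x) G,
      prim G U & [/\ U (-1) = 0, U 1 = 0 & I U = 0]].

Lemma prim_psi : prim (fun x => - x) (@psi R).
Proof.
have p1 := primM prim_id prim_id.
have p2 := primD (prim_cst (1 / 2)) (primZ (- (1 / 2)) p1).
by apply: prim_ext p2 _ _ => x _; rewrite /psi; field.
Qed.

Lemma bm_psi : bm (@psi R).
Proof. exact: prim_bm prim_psi. Qed.

Lemma I_psi : I (@psi R) = 2 / 3.
Proof.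
have p1 := primM prim_id (primM prim_id prim_id).
have p2 := primD (primZ (1 / 2) prim_id) (primZ (- (1 / 6)) p1).
have h := prim_int p2.
rewrite (_ : I (@psi R) = 1 / 2 * 1 + - (1 / 6) * (1 * (1 * 1)) -
   (1 / 2 * (-1) + - (1 / 6) * (-1 * (-1 * -1)))); first by field.
by apply: etrans h; apply: I_ext => t _; rewrite /psi; field.
Qed.

Lemma I_sqr : I (fun x => x ^+ 2) = 2 / 3.
Proof.
have h := prim_int (primZ (1 / 3) (primM prim_id (primM prim_id prim_id))).
rewrite (_ : I _ = 1 / 3 * (1 * (1 * 1)) - 1 / 3 * (-1 * (-1 * -1))); first by field.
by apply: etrans h; apply: I_ext => t _; field.
Qed.

(** * Integral identities of a state *)

Section State.
Variables (lam : R) (s G U : R -> R).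
Hypothesis st : is_state lam s G U.
Let h x := lam + s x.
Let bs : bm s. Proof. by case: st. Qed.
Let pG : prim h G. Proof. by case: st. Qed.
Let pU : prim G U. Proof. by case: st. Qed.
Let U0 : U (-1) = 0. Proof. by case: st => _ _ _ _ []. Qed.
Let U1 : U 1 = 0. Proof. by case: st => _ _ _ _ []. Qed.
Let IU : I U = 0. Proof. by case: st => _ _ _ _ []. Qed.
Let bh : bm h. Proof. by case: pG. Qed.
Let bG : bm G. Proof. exact: prim_bm pG. Qed.
Let bU : bm U. Proof. exact: prim_bm pU. Qed.
Let bid : bm (fun x : R => x) := bm_id.

Definition energy := I (fun x => G x ^+ 2).

Lemma energyE : energy = - I (fun x => h x * U x).
Proof.
have := prim_int (primM pU pG); rewrite U0 U1 !mul0r subrr.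
rewrite ID; [|bmt|bmt].
rewrite (_ : I (fun t => G t * G t) = energy); last first.
  by apply: I_ext => t _; rewrite -expr2.
rewrite (_ : I (fun t => U t * h t) = I (fun x => h x * U x)); last first.
  by apply: I_ext => t _; rewrite mulrC.
lra.
Qed.

Lemma I_xG : I (fun x => x * G x) = 0.
Proof.
have := prim_int (primM prim_id pU); rewrite U0 U1 !mulr0 subrr.
rewrite ID; [|bmt|bmt].
rewrite (_ : I (fun t => 1 * U t) = 0) ?add0r//.
by apply: etrans IU; apply: I_ext => t _; rewrite mul1r.
Qed.

(** Since [psi'' = -1] and [psi] vanishes at both ends, pairing [u''] with [psi] gives [- \int u],
    which is 0. The mean-zero constraint thus becomes a constraint on [A] alone. *)
Lemma I_hpsi : I (fun x => h x * psi x) = 0.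
Proof.
have bp := bm_psi.
have := prim_int (primM pG prim_psi).
rewrite (_ : psi 1 = 0); last by rewrite /psi; field.
rewrite (_ : psi (-1) = 0); last by rewrite /psi; field.
rewrite !mulr0 subrr ID; [|bmt|bmt].
rewrite (_ : I (fun t => G t * - t) = 0) ?addr0//.
have := I_xG; rewrite -[I _]opprK -IN; last by bmt.
move/eqP; rewrite oppr_eq0 => /eqP e; apply: etrans e.
by apply: I_ext => t _; ring.
Qed.

Section Test.
Variable c : R.
(** Adding [c psi] keeps the Dirichlet conditions and shifts the second derivative by the constant
    [- c]. *)
Definition excess x := U x + c * psi x.
Definition excess' x := G x - c * x.
Let f := excess.
Let f' := excess'.

Lemma prim_excess : prim f' f.
Proof.
apply: prim_ext (primD pU (primZ c prim_psi)) _ _ => // x _.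
by rewrite /f' /excess'; ring.
Qed.

Let bf : bm f. Proof. exact: prim_bm prim_excess. Qed.
Let bf' : bm f'. Proof. by case: prim_excess. Qed.

Lemma excessN1 : f (-1) = 0.
Proof. by rewrite /f /excess U0 /psi; field. Qed.

Lemma excess1 : f 1 = 0.
Proof. by rewrite /f /excess U1 /psi; field. Qed.

Lemma prim_excessN : prim (fun x => - f' x) (fun x => - f x).
Proof. by apply: prim_ext (primZ (-1) prim_excess) _ _ => x _; ring. Qed.

Lemma I_excess : I f = 2 * c / 3.
Proof.
have bp := bm_psi.
by rewrite ID; [|bmt|bmt]; rewrite IZ// IU I_psi; field.
Qed.

Lemma I_sexcess : I (fun x => s x * f x) = - energy - 2 * c * lam / 3.
Proof.
have bp := bm_psi.
rewrite energyE.
rewrite (_ : I (fun x => s x * f x) =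
  I (fun x => h x * U x + (c * (h x * psi x) + - lam * f x))); last first.
  by apply: I_ext => t _; rewrite /h /f /excess; ring.
rewrite ID; [|bmt|bmt]; rewrite ID; [|bmt|bmt]; rewrite !IZ; [|bmt|bmt].
by rewrite I_hpsi I_excess; field.
Qed.

Lemma I_excess'_sqr : I (fun x => f' x ^+ 2) = energy + 2 * c ^+ 2 / 3.
Proof.
rewrite (_ : I (fun x => f' x ^+ 2) =
  I (fun x => G x ^+ 2 + (- (2 * c) * (x * G x) + c ^+ 2 * (x ^+ 2)))); last first.
  by apply: I_ext => t _; rewrite /f' /excess'; ring.
rewrite ID; [|bmt|bmt]; rewrite ID; [|bmt|bmt]; rewrite !IZ; [|bmt|bmt].
by rewrite I_xG I_sqr /energy; field.
Qed.

Let p := I (ind f).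
Let q := I (ind (fun x => - f x)).

(** As [|s| = 1] inside the interval, the integrand is nonnegative there and vanishes exactly where
    [f = 0] or [s] is opposite to the sign of [f]. *)
Definition mismatch := I (fun x => `|f x| + s x * f x).
Definition flat := I (fun x => (1 - ind f x - ind (fun x => - f x) x) * f' x ^+ 2).
Definition arcP k := I (arc f' f k).
Definition arcN k := I (arc (fun x => - f' x) (fun x => - f x) k).

Lemma absE x : `|f x| = pos f x + pos (fun x => - f x) x.
Proof.
rewrite /pos; case: (leP (f x) 0) => fx.
  by rewrite ler0_norm// add0r max_l// oppr_ge0.
by rewrite gtr0_norm// max_r ?addr0// oppr_le0 ltW.
Qed.

Lemma posB x : f x = pos f x - pos (fun x => - f x) x.
Proof.
rewrite /pos; case: (leP (f x) 0) => fx.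
  by rewrite max_l ?oppr_ge0//; ring.
by rewrite max_r ?subr0// oppr_le0 ltW.
Qed.

(** The weights [1 - k] and [1 + k] of the two arcs contribute [- 2 \int |f| + 2 k \int f]. The
    first term cancels against [2 * mismatch], leaving [2 \int s f], which contains [- 2 E]; the
    squared slopes on the two arcs and on [f = 0] add up to [\int f'^2], which contains [E]. *)
Lemma ledger k : arcP (1 - k) + arcN (1 + k) + flat + 2 * mismatch =
  - energy + 2 * c ^+ 2 / 3 + 4 * k * c / 3 - 4 * c * lam / 3 +
  ((1 - k) ^+ 2 * p ^+ 3 + (1 + k) ^+ 2 * q ^+ 3) / 12.
Proof.
have bNf : bm (fun x => - f x) by bmt.
have bi := bm_ind bf; have bi' := bm_ind bNf.
have bp := bm_pos bf; have bp' := bm_pos bNf.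
have hP := @arc_identity _ _ prim_excess excessN1 excess1 (1 - k).
have hN := @arc_identity _ _ prim_excessN _ _ (1 + k).
have {}hN := hN ltac:(by rewrite excessN1 oppr0) ltac:(by rewrite excess1 oppr0).
have hM : mismatch = I (pos f) + I (pos (fun x => - f x)) + I (fun x => s x * f x).
  rewrite -!ID//; last 2 first. by bmt. by bmt.
  by apply: I_ext => t _; rewrite absE.
have hF : flat = I (fun x => f' x ^+ 2) - I (fun x => ind f x * f' x ^+ 2)
   - I (fun x => ind (fun x => - f x) x * (- f' x) ^+ 2).
  rewrite -!IN; [|bmt|bmt]. rewrite -!ID; [|bmt|bmt|bmt|bmt].
  by apply: I_ext => t _; ring.
have hB : I (pos f) - I (pos (fun x => - f x)) = 2 * c / 3.
  rewrite -I_excess -IN// -ID//; last by bmt.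
  by apply: I_ext => t _; rewrite -posB.
rewrite /arcP /arcN hP hN hF hM I_sexcess I_excess'_sqr -/p -/q.
have -> : I (pos f) = 2 * c / 3 + I (pos (fun x => - f x)) by rewrite -hB subrK.
by field.
Qed.

Lemma mismatch_fun_ge0 x : -1 < x <= 1 -> 0 <= `|f x| + s x * f x.
Proof.
rewrite le_eqVlt => /andP[x0 /predU1P[->|x1]].
  by rewrite excess1 normr0 mulr0 addr0.
have [_ /(_ x)] := st; rewrite x0 x1 => /(_ isT) s1 _ _ _.
have := ler_norm (- (s x * f x)); rewrite normrN normrM s1 mul1r; lra.
Qed.

Lemma mismatch_ge0 : 0 <= mismatch.
Proof. exact/I_ge0/mismatch_fun_ge0. Qed.

Lemma flat_ge0 : 0 <= flat.
Proof.
apply: I_ge0 => t _; apply: mulr_ge0; last exact: sqr_ge0.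
by rewrite /ind oppr_gt0; case: ltgtP => _; lra.
Qed.

Lemma arc_ge0 g F k : 0 <= I (arc g F k).
Proof.
apply: I_ge0 => t _; apply: mulr_ge0; last exact: sqr_ge0.
by rewrite /ind; case: ifP.
Qed.

End Test.

Variable xi : R.
Hypotheses (xi1 : -1 < xi < 1) (lamE : lam = (3 * xi - xi ^+ 3) / 2).
Let c0 := xi * (1 - xi ^+ 2) / 2.

(* The weight [k] minimises the right-hand side of [ledger] once [p] and [q]
   are replaced by the lengths [1 + xi] and [1 - xi] of the two arcs of the optimum. *)
Definition weight c := (3 * xi + xi ^+ 3 - 4 * c) / (1 + 3 * xi ^+ 2).

(** At [k = weight c] and measures [1 + xi], [1 - xi], the bound on the energy read off from
    [ledger] is quadratic in [c]: its leading coefficient [- 2 (1 - xi^2) / (1 + 3 xi^2)] is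
    negative, its vertex is [c0], its top value [(1 - xi^2)^3 / 6]. Each remaining term is a loss,
    the cubes being so as long as [p <= 1 + xi] and [q <= 1 - xi]. *)
Lemma deficit c (k := weight c) (p := I (ind (excess c)))
    (q := I (ind (fun x => - excess c x))) :
  (1 - xi ^+ 2) ^+ 3 / 6 - energy =
  arcP c (1 - k) + arcN c (1 + k) + flat c + 2 * mismatch c +
  ((1 - k) ^+ 2 * ((1 + xi) ^+ 3 - p ^+ 3) + (1 + k) ^+ 2 * ((1 - xi) ^+ 3 - q ^+ 3)) / 12
  + 2 * (1 - xi ^+ 2) / (1 + 3 * xi ^+ 2) * (c - c0) ^+ 2.
Proof.
rewrite (ledger c k) -/p -/q.
have n0 : 1 + 3 * xi ^+ 2 != 0 by rewrite gt_eqF//; have := sqr_ge0 xi; lra.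
by rewrite /k /weight /c0 lamE; field.
Qed.

End State.

(** * Quantiles and positivity regions *)

Lemma psi_ge0 x : -1 <= x <= 1 -> 0 <= psi x.
Proof. by move=> /andP[? ?]; rewrite /psi; nra. Qed.

Lemma psi_gt0 x : -1 < x < 1 -> 0 < psi x.
Proof. by move=> /andP[? ?]; rewrite /psi; nra. Qed.

Lemma bm_excess U c : bm U -> bm (excess U c).
Proof. by move=> bU; have bp := bm_psi; rewrite /excess; bmt. Qed.

Lemma Int_ae_ge0 f x y : -1 <= x -> y <= 1 -> bm f ->
  (\forall t \ae mu, x < t < y -> 0 <= f t) -> 0 <= Int x y f.
Proof.
move=> x1 y1 bf f0.
have bp := bm_pos bf.
rewrite (_ : Int x y f = Int x y (pos f)).
  by apply: Int_ge0 => t _; rewrite /pos le_max lexx orbT.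
have fi := bm_integrable x1 y1 bf; have gi := bm_integrable x1 y1 bp.
rewrite /Int /Rintegral; congr fine; apply: ae_eq_integral => //.
- by have /integrableP[] := fi.
- by have /integrableP[] := gi.
apply: ae_imp2 f0 (ae_neq y) => t f0 ty; rewrite /= in_itv/= => /andP[xt ty'].
by rewrite /pos max_l// f0// xt lt_neqAle ty.
Qed.

Lemma Int_ae_ext f g x y : -1 <= x -> y <= 1 -> bm f -> bm g ->
  (\forall t \ae mu, x < t < y -> f t = g t) -> Int x y f = Int x y g.
Proof.
move=> x1 y1 bf bg fg; have bNf := bmN bf; have bNg := bmN bg.
have h1 : 0 <= Int x y (fun t => f t + - g t).
  apply: Int_ae_ge0 => //; first exact: bmD.
  by apply: ae_imp fg => t /[apply] ->; rewrite subrr.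
have h2 : 0 <= Int x y (fun t => g t + - f t).
  apply: Int_ae_ge0 => //; first exact: bmD.
  by apply: ae_imp fg => t /[apply] ->; rewrite subrr.
move: h1 h2; rewrite !IntD// !IntN//; lra.
Qed.

(** Because positivity is strict, a point with [U + c psi > 0] keeps this sign when [c] is lowered
    slightly, and no point with [psi >= 0] acquires it. The indicators therefore converge pointwise
    inside the interval. *)
Lemma mass_lower_semicont U c (e : nat -> R) p : bm U -> (forall n, 0 < e n) ->
  e n @[n --> \oo] --> 0 ->
  (forall n, I (ind (excess U (c - e n))) <= p) -> I (ind (excess U c)) <= p.
Proof.
move=> bU e0 ecvg ple.
have be d := bm_excess d bU.
have cv : I (ind (excess U (c - e n))) @[n --> \oo] --> I (ind (excess U c)).
  apply: (@Int_cvg _ _ 1); rewrite ?lexx//.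
  - exact: bm_ind.
  - by move=> n; exact: bm_ind.
  - by move=> n t _; rewrite /ind; case: ifP; rewrite ?normr1 ?normr0.
  move=> t tI; have p0 := ltW (psi_gt0 tI).
  rewrite {2}/ind; case: ltP => Ft; apply: cvg_near_cst.
    have d0 : 0 < excess U c t / (psi t + 1) by rewrite divr_gt0//; lra.
    move/cvgrPdist_le : ecvg => /(_ _ d0); apply: filterS => n.
    rewrite sub0r normrN (ger0_norm (ltW (e0 n))) ler_pdivlMr; last lra.
    have := e0 n; rewrite /ind => en h; case: ltP => //.
    have -> : excess U (c - e n) t = excess U c t - e n * psi t by rewrite /excess; ring.
    lra.
  apply: nearW => n; rewrite /ind; case: ltP => //.
  have -> : excess U (c - e n) t = excess U c t - e n * psi t by rewrite /excess; ring.
  have := mulr_ge0 (ltW (e0 n)) p0; lra.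
rewrite -(cvg_lim _ cv)//.
apply: limr_le; first by apply/cvg_ex; exists (I (ind (excess U c))).
exact: nearW.
Qed.

(** The quantile is the supremum of the [c] for which [0 < f] has measure at most [p]. At [c = - C]
    this set is null, and above [C] it is almost everything. Both bounds survive at the supremum by
    semicontinuity, applied to [U] and to [- U]. *)
Lemma mass_quantile U C p : bm U ->
  (forall x, -1 < x <= 1 -> `|U x| <= C * psi x) -> 0 < p < 2 ->
  exists c, I (ind (excess U c)) <= p /\ I (ind (fun x => - excess U c x)) <= 2 - p.
Proof.
move=> bU UC /andP[p0 p2].
have bi c : bm (ind (excess U c)) by apply: bm_ind; exact: bm_excess.
have bi' c : bm (ind (fun x => - excess U c x)).
  by apply: bm_ind; apply: bmN; exact: bm_excess.
pose S := [set c | I (ind (excess U c)) <= p].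
have S0 : S (- C).
  rewrite /S /= (@I_ext _ (fun=> 0)); first by rewrite Int_cst; lra.
  move=> t tI; rewrite /ind /excess; case: ltP => // h.
  have := UC _ tI; have := ler_norm (U t); lra.
have Sub : ubound S (C + 1).
  move=> c; rewrite /S /= => Ic; rewrite leNgt; apply/negP => Cc.
  have bic := bi c; have b1 : bm (fun x => 1 - ind (excess U c) x) by bmt.
  have : I (fun=> 1) = I (ind (excess U c)) + I (fun x => 1 - ind (excess U c) x).
    by rewrite -ID//; apply: I_ext => t _; ring.
  rewrite Int_cst; last lra.
  have -> : I (fun x => 1 - ind (excess U c) x) = 0.
    rewrite (@Int_ae_ext _ (fun=> 0)) ?lexx//; [rewrite Int_cst; lra|exact: bm_cst|].
    apply: aeW => t tI; rewrite /ind /excess; case: ltP; first by rewrite subrr.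
    have := psi_gt0 tI; move/andP : tI => [t0 t1].
    have := UC t; rewrite t0 (ltW t1) => /(_ isT); rewrite ler_norml => /andP[+ _].
    nra.
  lra.
have hS : has_sup S by split; [exists (- C) | exists (C + 1)].
have mono c d : c <= d -> I (ind (excess U c)) <= I (ind (excess U d)).
  move=> cd; apply: I_le => // t /andP[t0 t1].
  have /psi_ge0 pt : -1 <= t <= 1 by rewrite ltW.
  have : excess U c t <= excess U d t by rewrite /excess lerD2l ler_wpM2r.
  rewrite /ind; case: (ltP 0 (excess U c t)) => h1 //.
    by case: (ltP 0 (excess U d t)) => h2 h //; lra.
  by case: ifP.
have [e [e0 ecvg]] : exists e : nat -> R, (forall n, 0 < e n) /\ e n @[n --> \oo] --> 0.
  exists (fun n => n.+1%:R^-1); split; last exact: cvg_harmonic.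
  by move=> n; rewrite invr_gt0 ltr0n.
exists (sup S); split.
  apply: (mass_lower_semicont bU e0 ecvg) => n.
  have [c Sc] := sup_adherent (e0 n) hS.
  by move=> /ltW /mono /le_trans; apply.
have exN d x : - excess U d x = excess (fun x => - U x) (- d) x by rewrite /excess; ring.
rewrite (_ : (fun x => - excess U (sup S) x) = excess (fun x => - U x) (- sup S)); last first.
  by apply/funext => x; rewrite exN.
apply: (mass_lower_semicont (bmN bU) e0 ecvg) => n.
rewrite -opprD (_ : excess _ _ = (fun x => - excess U (sup S + e n) x)); last first.
  by apply/funext => x; rewrite exN.
have b1 := bi (sup S + e n); have b2 := bi' (sup S + e n).
(* Above the supremum the positive set exceeds [p]; the negative set, being disjoint from it in an
   interval of length 2, has measure below [2 - p]. *)
have h : p < I (ind (excess U (sup S + e n))).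
  rewrite ltNge; apply/negP => h.
  have := sup_ubound (ex_intro _ _ Sub) (h : S _); have := e0 n; lra.
have : I (fun x => ind (excess U (sup S + e n)) x +
    ind (fun x => - excess U (sup S + e n) x) x) <= I (fun=> 1).
  apply: I_le; [bmt|bmt|] => t _; rewrite /ind oppr_gt0.
  by case: ltgtP; rewrite ?addr0 ?add0r.
rewrite ID// Int_cst; lra.
Qed.

(** Locates the start of the final stretch of positivity before [y]. The Lipschitz bound makes the
    nonpositive set closed, so its supremum belongs to it. *)
Lemma last_nonpos F (M w y : R) : 0 <= M -> w <= y -> F w <= 0 ->
  (forall a b, w <= a <= y -> w <= b <= y -> `|F a - F b| <= M * `|a - b|) ->
  exists b, [/\ w <= b <= y, F b <= 0 & forall t, b < t <= y -> 0 < F t].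
Proof.
move=> M0 wy Fw lip.
pose S := [set z | w <= z <= y /\ F z <= 0].
have Sw : S w by split=> //; rewrite lexx.
have Sub : ubound S y by move=> z [/andP[]].
have hS : has_sup S by split; [exists w | exists y].
have wb : w <= sup S by apply: sup_ubound => //; exists y.
have bY : sup S <= y by apply: ge_sup => //; exists w.
exists (sup S); split; first by rewrite wb.
  rewrite leNgt; apply/negP => Fb.
  have d0 : 0 < F (sup S) / (M + 1) by rewrite divr_gt0//; lra.
  have [z [zI Fz] zb] := sup_adherent d0 hS.
  have zs : z <= sup S by apply: sup_ubound => //; exists y.
  have := lip (sup S) z; rewrite wb bY => /(_ isT zI).
  rewrite [`|sup S - z|]ger0_norm ?subr_ge0// => h.
  have {}h := le_trans (ler_norm _) h.
  have h2 : (sup S - z) * (M + 1) < F (sup S) by rewrite -ltr_pdivlMr; lra.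
  nra.
move=> t /andP[bt ty]; rewrite ltNge; apply/negP => Ft.
have : t <= sup S by apply: sup_ubound; [exists y|split=> //; rewrite ty andbT; lra].
lra.
Qed.

Lemma prim_lipschitz g F : prim g F -> exists2 M : R, 0 <= M &
  forall a b, -1 <= a <= 1 -> -1 <= b <= 1 -> `|F a - F b| <= M * `|a - b|.
Proof.
move=> pF; have [M M0 [_ MF]] := prim_lip pF; exists M => // x y.
move=> /andP[? ?] /andP[? ?]; case: (leP x y) => xy.
  by rewrite distrC [`|x - y|]distrC [`|y - x|]ger0_norm ?MF//; lra.
by rewrite [`|x - y|]ger0_norm ?MF//; lra.
Qed.

(* [F] increases on [0 < F] up to the median of that set and decreases afterwards,
   so it cannot return to a positive value after having vanished. *)
Lemma arc_convex g F k (p := I (ind F)) : prim g F -> 0 <= k ->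
  (\forall t \ae mu, -1 < t <= 1 -> 0 < F t -> g t + k * (Int (-1) t (ind F) - p / 2) = 0) ->
  forall x w y, -1 <= x -> x < w -> w < y -> y <= 1 -> 0 < F x -> 0 < F y -> 0 < F w.
Proof.
move=> pF k0 gE x w y x1 xw wy y1 Fx Fy; rewrite ltNge; apply/negP => Fw.
have [M M0 lip] := prim_lipschitz pF; have bi := bm_ind (prim_bm pF).
have [bg Fg] := pF.
have mle a b : -1 <= a -> a <= b -> b <= 1 -> Int (-1) a (ind F) <= Int (-1) b (ind F).
  move=> *; rewrite [leRHS](@Int_cat _ _ a)// lerDl; apply: Int_ge0 => t _.
  by rewrite /ind; case: ifP.
(* With [w] past the median, [F] would have to climb from [F b <= 0] to [F y > 0] along a stretch
   where its slope is nonpositive. Before the median, the mirrored function gives the same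
   contradiction on the side of [x]. *)
have [mw|mw] := leP (p / 2) (Int (-1) w (ind F)).
- have [|b [/andP[wb bY] Fb Fpos]] := @last_nonpos F M w y M0 (ltW wy) Fw.
    by move=> a b /andP[? ?] /andP[? ?]; apply: lip; lra.
  have : 0 <= Int b y (fun t => - g t).
    apply: Int_ae_ge0 => //; [lra|exact: bmN|].
    apply: ae_imp gE => t gt /andP[bt ty].
    have := mle w t; have := gt; rewrite Fpos ?bt ?(ltW ty)// => {}gt.
    have {}gt := gt ltac:(lra) isT => h; have := h ltac:(lra) ltac:(lra) ltac:(lra).
    nra.
  by rewrite IntN//; [rewrite -Fg//; lra|lra].
- have [|b [/andP[wb bY] Fb Fpos]] := 
      @last_nonpos (fun t => F (- t)) M (- w) (- x) M0 ltac:(lra)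
      ltac:(by rewrite /= opprK).
    move=> a b /andP[? ?] /andP[? ?].
    have -> : `|a - b| = `|- a - - b| by rewrite -normrN; congr (`|_|); ring.
    by apply: lip; lra.
  have : 0 <= Int x (- b) g.
    apply: Int_ae_ge0 => //; [lra|].
    apply: ae_imp gE => t gt /andP[xt tb].
    have := mle t w; have := Fpos (- t); rewrite opprK => Ft.
    have {}Ft := Ft ltac:(lra).
    have {}gt := gt ltac:(lra) Ft => h; have := h ltac:(lra) ltac:(lra) ltac:(lra).
    nra.
  by rewrite -Fg//; lra.
Qed.

(** With [s] the supremum of [0 < F], the ordering gives measures at most [1 + s] and [1 - s]. The
    prescribed measures [1 + b] and [1 - b] leave only [s = b]. *)
Lemma separated_regions g F : prim g F -> forall b, -1 < b < 1 ->
  I (ind F) = 1 + b -> I (ind (fun x => - F x)) = 1 - b ->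
  (forall x y, -1 <= x <= 1 -> -1 <= y <= 1 -> 0 < F x -> F y < 0 -> x < y) ->
  forall t, -1 < t < 1 -> (0 < F t -> t <= b) /\ (F t < 0 -> b <= t).
Proof.
move=> pF b /andP[b0 b1] mP mN sep.
have bi := bm_ind (prim_bm pF); have bi' := bm_ind (bmN (prim_bm pF)).
pose S := [set x | -1 <= x <= 1 /\ 0 < F x].
have [x [xI Fx]] : S !=set0.
  apply/set0P/negP => /eqP S0; move: mP.
  rewrite (@I_ext _ (fun=> 0)); first by rewrite Int_cst; lra.
  move=> t tI; rewrite /ind; case: ltP => // Ft.
  have : S t by split => //; lra.
  by rewrite S0.
have Sub : ubound S 1 by move=> y [/andP[]].
have hS : has_sup S by split; [exists x | exists 1].
have x1 := sup_ubound (ex_intro _ _ Sub) (conj xI Fx : S x).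
have s1 : sup S <= 1 by apply: ge_sup => //; exists x.
have up t : -1 <= t <= 1 -> 0 < F t -> t <= sup S.
  by move=> tI Ft; apply: sup_ubound; [exists 1 | split].
have lo t : -1 <= t <= 1 -> F t < 0 -> sup S <= t.
  by move=> tI Ft; apply: ge_sup; [exists x | move=> y [yI Fy]; exact/ltW/sep].
have sE : sup S = b.
  apply/eqP; rewrite eq_le; apply/andP; split.
    have : I (ind (fun x => - F x)) <= 1 - sup S.
      rewrite (@Int_cat _ (-1) (sup S) 1)//; [|lra].
      have -> : Int (-1) (sup S) (ind (fun x => - F x)) = 0.
        rewrite (@Int_ae_ext _ (fun=> 0))//; [rewrite Int_cst; lra|exact: bm_cst|].
        apply: aeW => t /andP[t0 ts].
        by rewrite /ind oppr_gt0; case: ltP => // /lo; lra.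
      rewrite add0r -[leRHS]mul1r -Int_cst//; apply: Int_le => //; [lra|exact: bm_cst|].
      by move=> t _; rewrite /ind; case: ifP.
    by rewrite mN; lra.
  have : I (ind F) <= 1 + sup S.
    rewrite (@Int_cat _ (-1) (sup S) 1)//; [|lra].
    have -> : Int (sup S) 1 (ind F) = 0.
      rewrite (@Int_ext _ (fun=> 0))//; [by rewrite Int_cst// mul0r|lra|].
      move=> t /andP[st t1]; rewrite /ind; case: ltP => // /up; lra.
    rewrite addr0 addrC -[leRHS]mul1r -[X in _ * (_ + X)]opprK -Int_cst; last lra.
    apply: Int_le => //; first exact: bm_cst.
    by move=> t _; rewrite /ind; case: ifP.
  by rewrite mP; lra.
by move=> t tI; rewrite -sE; split; [apply: up | apply: lo]; lra.
Qed.

(** * The energy bound and its equality case *)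

Lemma weight_den_gt0 (x : R) : 0 < 1 + 3 * x ^+ 2.
Proof. by rewrite ltr_pwDl// mulr_ge0// sqr_ge0. Qed.

Lemma quad_coef_gt0 (x : R) : -1 < x < 1 -> 0 < 2 * (1 - x ^+ 2) / (1 + 3 * x ^+ 2).
Proof.
by move=> /andP[? ?]; apply: divr_gt0; [nra | exact: weight_den_gt0].
Qed.

Lemma deficit_ge0 (a b c d e e' g : R) : 0 <= a -> 0 <= b -> 0 <= c -> 0 <= d ->
  0 <= e -> 0 <= e' -> 0 <= g -> 0 <= a + b + c + 2 * d + (e + e') / 12 + g.
Proof. by move=> *; lra. Qed.

Lemma deficit_eq0 (a b c d e e' g : R) : 0 <= a -> 0 <= b -> 0 <= c -> 0 <= d ->
  0 <= e -> 0 <= e' -> 0 <= g -> a + b + c + 2 * d + (e + e') / 12 + g = 0 ->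
  [/\ a = 0, b = 0, d = 0, g = 0 & e = 0 /\ e' = 0].
Proof. by move=> *; do ?split; lra. Qed.

Lemma cube_inj (k p b : R) : 0 < k -> 0 <= p -> p <= b ->
  k ^+ 2 * (b ^+ 3 - p ^+ 3) = 0 -> p = b.
Proof.
move=> k0 p0 pb /eqP; rewrite mulf_eq0 sqrf_eq0 (gt_eqF k0)/= subr_eq0 => /eqP e.
by apply/eqP; rewrite -(eqrXn2 (n := 3))// ?e// (le_trans p0).
Qed.

Definition convex_pos F := forall x w y, -1 <= x -> x < w -> w < y -> y <= 1 ->
  0 < F x -> 0 < F y -> 0 < F w.

(** A pair in the reverse order would place a point of one region between two points of the other,
    against convexity and disjointness; which region is hit depends on the order of [x'] and [y]. *)
Lemma regions_ordered F H : convex_pos F -> convex_pos H ->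
  (forall x, 0 < F x -> 0 < H x -> False) ->
  forall x y, -1 <= x <= 1 -> -1 <= y <= 1 -> 0 < F x -> 0 < H y -> x < y ->
  forall x' y', -1 <= x' <= 1 -> -1 <= y' <= 1 -> 0 < F x' -> 0 < H y' -> x' < y'.
Proof.
move=> cF cH FH x y /andP[? ?] /andP[? ?] Fx Hy xy x' y' /andP[? ?] /andP[? ?] Fx' Hy'.
have ne a b : 0 < F a -> 0 < H b -> a != b.
  by move=> Fa Hb; apply/eqP => ab; rewrite ab in Fa; exact: FH Fa Hb.
rewrite ltNge; apply/negP => yx'.
have yx : y' < x' by rewrite lt_neqAle yx' andbT eq_sym ne.
have [x'y|yx''] := ltP x' y.
  by apply: (FH x') => //; apply: (cH y' x' y).
have yx2 : y < x' by rewrite lt_neqAle yx'' andbT eq_sym ne.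
by apply: (FH y) => //; apply: (cF x y x').
Qed.

Lemma arc_ae g F k : prim g F -> I (arc g F k) = 0 ->
  \forall t \ae mu, -1 < t <= 1 -> 0 < F t ->
    g t + k * (Int (-1) t (ind F) - I (ind F) / 2) = 0.
Proof.
move=> pF A0.
have a0 t : -1 < t <= 1 -> 0 <= arc g F k t.
  by move=> _; rewrite /arc mulr_ge0 ?sqr_ge0// /ind; case: ifP.
have := I_eq0 (bm_arc pF k) a0 A0; apply: ae_imp => t /[apply] + Ft.
by rewrite /arc {1}/ind Ft mul1r => /eqP; rewrite sqrf_eq0 => /eqP.
Qed.

Lemma ind_compl_ge0 F t : 0 <= 1 - ind F t - ind (fun x => - F x) t.
Proof. by rewrite /ind oppr_gt0; case: ltgtP; rewrite ?subr0 ?subrr. Qed.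

Lemma ind_compl_eq0 F t : 1 - ind F t - ind (fun x => - F x) t = 0 -> F t != 0.
Proof.
rewrite /ind oppr_gt0; case: ltgtP => // _ /eqP.
by rewrite !subr0 oner_eq0.
Qed.

Lemma balanced_sign (a b : R) : a != 0 -> `|a| + b * a = 0 ->
  (0 < a /\ b = -1) \/ (a < 0 /\ b = 1).
Proof.
move=> an h; have [a0|a0|a0] := ltgtP a 0; last by rewrite a0 eqxx in an.
  by right; split => //; apply: (mulIf an); move: h; rewrite ltr0_norm//; lra.
by left; split => //; apply: (mulIf an); move: h; rewrite gtr0_norm//; lra.
Qed.

(** The two measures exhaust the interval, so [F] is nonzero almost everywhere and the vanishing
    mismatch fixes [s] there. Two disjoint convex regions have a single interface, at [xi] or [- xi]
    according to which one comes first. *)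
Lemma two_regions g F s xi : prim g F -> bm s -> -1 < xi < 1 ->
  I (ind F) = 1 + xi -> I (ind (fun x => - F x)) = 1 - xi ->
  convex_pos F -> convex_pos (fun x => - F x) ->
  (forall t, -1 < t <= 1 -> 0 <= `|F t| + s t * F t) ->
  I (fun t => `|F t| + s t * F t) = 0 ->
  (\forall x \ae mu, -1 < x < 1 -> (x < xi -> s x = -1) /\ (xi < x -> s x = 1)) \/
  (\forall x \ae mu, -1 < x < 1 -> (x < - xi -> s x = 1) /\ (- xi < x -> s x = -1)).
Proof.
move=> pF bs xi1 mp mq cP cN mm0 M0.
have bF := prim_bm pF; have bNF := bmN bF; have bi := bm_ind bF; have bi' := bm_ind bNF.
have nz : \forall t \ae mu, -1 < t <= 1 -> F t != 0.
  have b1 : bm (fun x => 1 - ind F x - ind (fun x => - F x) x) by bmt.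
  have z0 : I (fun x => 1 - ind F x - ind (fun x => - F x) x) = 0.
    rewrite ID; [|bmt|bmt]; rewrite ID; [|bmt|bmt].
    rewrite !IN// Int_cst ?mp ?mq; lra.
  have := I_eq0 b1 (fun t _ => ind_compl_ge0 F t) z0.
  by apply: ae_imp => t /[apply] /ind_compl_eq0.
have mm : \forall t \ae mu, -1 < t <= 1 -> `|F t| + s t * F t = 0.
  by apply: I_eq0 M0 => //; bmt.
have sgn : \forall t \ae mu, -1 < t < 1 -> (0 < F t /\ s t = -1) \/ (F t < 0 /\ s t = 1).
  apply: ae_imp2 nz mm => t h h' /andP[t0 t1].
  by apply: balanced_sign; [apply: h | apply: h']; rewrite t0 ltW.
have disj x : 0 < F x -> 0 < - F x -> False by rewrite oppr_gt0; lra.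
have exP : exists2 x, -1 <= x <= 1 & 0 < F x.
  apply: contrapT => nP; move: mp; rewrite (@I_ext _ (fun=> 0)); first by rewrite Int_cst; lra.
  move=> t /andP[t0 t1]; rewrite /ind; case: ltP => // ft.
  by exfalso; apply: nP; exists t => //; rewrite ltW.
have exN : exists2 x, -1 <= x <= 1 & 0 < - F x.
  apply: contrapT => nP; move: mq; rewrite (@I_ext _ (fun=> 0)); first by rewrite Int_cst; lra.
  move=> t /andP[t0 t1]; rewrite /ind; case: ltP => // ft.
  by exfalso; apply: nP; exists t => //; rewrite ltW.
have [x xI fx] := exP; have [y yI fy] := exN.
have [xy|yx] := ltP x y.
  left; have sep : forall t, -1 < t < 1 -> (0 < F t -> t <= xi) /\ (F t < 0 -> xi <= t).
    apply: (separated_regions pF xi1 mp mq) => x' y' x'I y'I fx' fy'.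
    apply: (regions_ordered cP cN disj xI yI fx fy xy x'I y'I fx').
    by rewrite oppr_gt0.
  apply: ae_imp sgn => t h tI; have [s1 s2] := sep _ tI.
  by case: (h tI) => -[ft ->]; split => // tx; [have := s1 ft|have := s2 ft]; lra.
right.
have xi1' : -1 < - xi < 1 by lra.
have mq' : I (ind (fun x => - F x)) = 1 + - xi by rewrite mq.
have mp' : I (ind (fun x => - - F x)) = 1 - - xi.
  by rewrite opprK -mp; congr Int; apply/funext => t; rewrite /ind opprK.
have xy : y < x.
  rewrite lt_neqAle yx andbT; apply/eqP => e; rewrite e in fy; exact: disj fx fy.
have pNF : prim (fun x => - g x) (fun x => - F x).
  by apply: prim_ext (primZ (-1) pF) _ _ => t _; rewrite mulN1r.
have sep : forall t, -1 < t < 1 -> (0 < - F t -> t <= - xi) /\ (- F t < 0 -> - xi <= t).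
  apply: (separated_regions pNF xi1' mq' mp') => x' y' x'I y'I fx' fy'.
  apply: (regions_ordered cN cP _ yI xI fy fx xy x'I y'I fx').
  - by move=> z ? ?; exact: (disj z).
  - by rewrite -oppr_lt0.
apply: ae_imp sgn => t h tI; have [s1 s2] := sep _ tI.
case: (h tI) => -[ft ->]; split => // tx.
  by have := s2; rewrite oppr_lt0 => /(_ ft); lra.
by have := s1; rewrite oppr_gt0 => /(_ ft); lra.
Qed.

Section Bound.
Variables (lam : R) (s G U : R -> R) (xi : R).
Hypotheses (st : is_state lam s G U) (xi1 : -1 < xi < 1)
  (lamE : lam = (3 * xi - xi ^+ 3) / 2).

(** [U] is Lipschitz and vanishes at both ends, so it is bounded by a multiple of the distance to
    the boundary, itself at most [2 psi]. This confines the quantiles of [U / psi] to a bounded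
    range. *)
Lemma state_psi_bound : exists C, forall x, -1 < x <= 1 -> `|U x| <= C * psi x.
Proof.
have [_ _ _ pU [U0 U1 _]] := st.
have [M M0 [_ MU]] := prim_lip pU.
exists (2 * M) => x /andP[x0 x1].
have h1 := MU (-1) x; have h2 := MU x 1.
have {}h1 := h1 (lexx _) ltac:(lra) x1; have {}h2 := h2 ltac:(lra) x1 (lexx _).
move: h1 h2; rewrite U0 U1 subr0 sub0r normrN /psi => h1 h2.
have [x0'|x0'] := leP x 0; nra.
Qed.

Let f c := excess U c.

Lemma deficit_parts : exists c (k := weight xi c),
  [/\ I (ind (f c)) <= 1 + xi, I (ind (fun x => - f c x)) <= 1 - xi &
      (1 - xi ^+ 2) ^+ 3 / 6 - energy G =
      arcP G U c (1 - k) + arcN G U c (1 + k) + flat G U c + 2 * mismatch s U c +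
      ((1 - k) ^+ 2 * ((1 + xi) ^+ 3 - I (ind (f c)) ^+ 3) +
       (1 + k) ^+ 2 * ((1 - xi) ^+ 3 - I (ind (fun x => - f c x)) ^+ 3)) / 12 +
      2 * (1 - xi ^+ 2) / (1 + 3 * xi ^+ 2) * (c - xi * (1 - xi ^+ 2) / 2) ^+ 2].
Proof.
have [_ _ _ pU _] := st.
have [C UC] := state_psi_bound.
have /andP[xi0 xi2] := xi1.
have [|c [cp cq]] := @mass_quantile U C (1 + xi) (prim_bm pU) UC; first lra.
exists c; split => //; first by lra.
exact (deficit st lamE c).
Qed.

Lemma mass_ge0 F : 0 <= I (ind F).
Proof. by apply: I_ge0 => t _; rewrite /ind; case: ifP. Qed.

Lemma cube_defect_ge0 (k p b : R) : 0 <= p -> p <= b -> 0 <= k ^+ 2 * (b ^+ 3 - p ^+ 3).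
Proof.
move=> p0 pb; apply: mulr_ge0; first exact: sqr_ge0.
by rewrite subr_ge0 lerXn2r// nnegrE (le_trans p0).
Qed.

Lemma energy_le : energy G <= (1 - xi ^+ 2) ^+ 3 / 6.
Proof.
have [c [hp hq hd]] := deficit_parts.
have h1 := arc_ge0 (excess' G c) (f c) (1 - weight xi c).
have h2 := arc_ge0 (fun x => - excess' G c x) (fun x => - f c x) (1 + weight xi c).
have h3 := flat_ge0 G U c; have h4 := mismatch_ge0 st c.
have h5 := cube_defect_ge0 (1 - weight xi c) (mass_ge0 _) hp.
have h6 := cube_defect_ge0 (1 + weight xi c) (mass_ge0 _) hq.
have h7 := mulr_ge0 (ltW (quad_coef_gt0 xi1)) (sqr_ge0 (c - xi * (1 - xi ^+ 2) / 2)).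
by rewrite -subr_ge0 hd; exact (deficit_ge0 h1 h2 h3 h4 h5 h6 h7).
Qed.

Lemma rigidity : energy G = (1 - xi ^+ 2) ^+ 3 / 6 ->
  (\forall x \ae mu, -1 < x < 1 -> (x < xi -> s x = -1) /\ (xi < x -> s x = 1)) \/
  (\forall x \ae mu, -1 < x < 1 -> (x < - xi -> s x = 1) /\ (- xi < x -> s x = -1)).
Proof.
move=> EV.
have [c [hp hq]] := deficit_parts.
have h1 := arc_ge0 (excess' G c) (f c) (1 - weight xi c).
have h2 := arc_ge0 (fun x => - excess' G c x) (fun x => - f c x) (1 + weight xi c).
have h3 := flat_ge0 G U c; have h4 := mismatch_ge0 st c.
have h5 := cube_defect_ge0 (1 - weight xi c) (mass_ge0 _) hp.
have h6 := cube_defect_ge0 (1 + weight xi c) (mass_ge0 _) hq.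
have /andP[xi0 xi2] := xi1.
have d0 := quad_coef_gt0 xi1.
have h7 := mulr_ge0 (ltW d0) (sqr_ge0 (c - xi * (1 - xi ^+ 2) / 2)).
rewrite EV subrr => /esym e0.
have [P0 N0 M0 C0 [A0 B0]] := deficit_eq0 h1 h2 h3 h4 h5 h6 h7 e0.
have cE : c = xi * (1 - xi ^+ 2) / 2.
  by move/eqP : C0; rewrite mulf_eq0 (gt_eqF d0) sqrf_eq0 subr_eq0 => /eqP.
(* At the vertex the multiplier is [xi], so both arc weights [1 - xi] and [1 + xi] are strictly
   positive and the vanishing cube defects determine the two measures. *)
have kE : weight xi c = xi.
  by rewrite /weight cE; field; rewrite gt_eqF// weight_den_gt0.
rewrite kE {h1 h2 h3 h4 h5 h6 h7 e0 d0 C0 cE kE EV} in P0 N0 A0 B0.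
have k1 : 0 < 1 - xi by rewrite subr_gt0.
have k2 : 0 < 1 + xi by rewrite -ltrBlDl sub0r.
have mp := cube_inj k1 (mass_ge0 _) hp A0.
have mq := cube_inj k2 (mass_ge0 _) hq B0.
clear A0 B0 hp hq lamE.
have pf := prim_excess st c; have pNf := prim_excessN st c.
have cP := arc_convex pf (ltW k1) (arc_ae pf P0).
have cN := arc_convex pNf (ltW k2) (arc_ae pNf N0).
apply: (two_regions pf) => //.
- by have [] := st.
- exact: mismatch_fun_ge0 st c.
Qed.

End Bound.

(** * Square-integrable functions *)

Lemma inner_bm f g : bm f -> bm g -> inner (D R) f g = I (fun x => f x * g x).
Proof.
move=> bf bg; rewrite /inner /Int /D Rintegral_itv_bndo_bndc//.
apply: integrableS (@bm_integrable (fun x => f x * g x) (-1) 1 (lexx _) (lexx _) (bmM bf bg)) => //.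
by apply: subset_itvl; rewrite bnd_simp.
Qed.

Lemma bm_integrableD f : bm f -> mu.-integrable (D R) (EFin \o f).
Proof.
move=> bf; apply: integrableS (@bm_integrable f (-1) 1 (lexx _) (lexx _) bf) => //.
  exact: measurable_itv.
by apply: subset_itvl; rewrite bnd_simp.
Qed.

Lemma L2_bm f : bm f -> L2 (D R) f.
Proof.
move=> bf; have mD : measurable (D R : set (measurableTypeR R)) by exact: measurable_itv.
rewrite /L2 inE/=; apply/andP; split; rewrite inE/=.
  apply/(measurable_restrictT _ mD).
  by have /integrableP[/measurable_EFinP] := bm_integrableD bf.
rewrite /finite_norm unlock poweR_lty//.
have /integrableP[_ h] := (integrable_mkcond _ mD).1 (bm_integrableD (bmX 2 bf)).
apply: le_lt_trans h; rewrite le_eqVlt; apply/orP; left; apply/eqP.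
apply: eq_integral => x _ /=; rewrite restrict_EFin /= /restrict; case: ifP => _ /=.
  by rewrite powR_mulrn// normrX.
by rewrite !normr0 powR0// pnatr_eq0.
Qed.

Lemma L2_integrable f g : L2 (D R) f -> L2 (D R) g ->
  mu.-integrable (D R) (EFin \o (fun x => f x * g x)).
Proof.
move=> lf lg; have mD : measurable (D R : set (measurableTypeR R)) by exact: measurable_itv.
apply: (integrable_mkcond _ mD).2.
have /Lfun1_integrable := Lfun2_mul_Lfun1 lf lg.
congr (mu.-integrable _ _); apply/funext => x /=.
by rewrite restrict_EFin /= /restrict; case: ifP; rewrite ?mulr0.
Qed.

Lemma L2B f g : L2 (D R) f -> L2 (D R) g -> L2 (D R) (f \- g).
Proof.
move=> lf lg; rewrite /L2.
have [_ lin] := Lfun_submod_closed (@lebesgue_measure R) (lee1n 2 : (1 <= 2%:E)%E).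
rewrite (_ : (f \- g) \_ (D R) = (-1) *: (g \_ (D R)) + f \_ (D R)); first exact: lin.
apply/funext => x.
transitivity (-1 * (g \_ (D R)) x + (f \_ (D R)) x) => //.
by rewrite /restrict /=; case: ifP => _; rewrite mulN1r ?oppr0 ?addr0// addrC.
Qed.

Lemma innerBl f g k : L2 (D R) f -> L2 (D R) g -> L2 (D R) k ->
  inner (D R) (f \- g) k = inner (D R) f k - inner (D R) g k.
Proof.
move=> lf lg lk; rewrite /inner -RintegralB; last 3 first.
- exact: measurable_itv.
- exact: L2_integrable.
- exact: L2_integrable.
by apply: eq_Rintegral => x _; rewrite mulrBl.
Qed.

Lemma inner_cs f g : L2 (D R) f -> L2 (D R) g ->
  inner (D R) f g ^+ 2 <= inner (D R) f f * inner (D R) g g.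
Proof.
move=> lf lg; have mD : measurable (D R : set (measurableTypeR R)) by exact: measurable_itv.
have h t : 0 <= inner (D R) f f + (2 * t * inner (D R) f g + t ^+ 2 * inner (D R) g g).
  have iff := L2_integrable lf lf; have ifg := L2_integrable lf lg.
  have igg := L2_integrable lg lg.
  have i1 : mu.-integrable (D R) (EFin \o (fun x => 2 * t * (f x * g x))).
    exact: (integrableZl mD (2 * t) ifg).
  have i2 : mu.-integrable (D R) (EFin \o (fun x => t ^+ 2 * (g x * g x))).
    exact: (integrableZl mD (t ^+ 2) igg).
  rewrite /inner -!RintegralZl// -!RintegralD//.
    apply: Rintegral_ge0 => x _.
    rewrite (_ : _ + _ = (f x + t * g x) ^+ 2); last by ring.
    exact: sqr_ge0.
  exact: (integrableD mD i1 i2).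
have : 0 <= inner (D R) g g by apply: Rintegral_ge0 => x _; rewrite -expr2 sqr_ge0.
move: h; move: (inner _ f f) (inner _ f g) (inner _ g g) => A B C h C0.
have [CE|Cn] := eqVneq C 0.
  rewrite CE mulr0; have [->|Bn] := eqVneq B 0; first by rewrite expr0n.
  (* In the degenerate case the quadratic is affine in [t], and this [t] is where it takes the value
     -1. *)
  have := h (- (A + 1) / (2 * B)).
  rewrite CE (_ : A + _ = -1); last by field.
  by rewrite oppr_ge0 ler10.
have Cp : 0 < C by rewrite lt_neqAle eq_sym Cn.
have := h (- B / C).
rewrite (_ : A + _ = (A * C - B ^+ 2) / C); last by field.
by rewrite pmulr_lge0 ?invr_gt0// subr_ge0.
Qed.

(** * Test functions *)

Definition C1 f := exists2 f' : R -> R, continuous f' & forall x, is_derive x 1 f (f' x).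

Lemma C1_continuous f : C1 f -> continuous f.
Proof.
move=> [f' _ df] x; apply: differentiable_continuous; apply/derivable1_diffP.
by have [] := df x.
Qed.

Lemma C1_cst c : C1 (fun=> c).
Proof. by exists (fun=> 0) => [x|x]; [exact: cvg_cst | exact: is_derive_cst]. Qed.

Lemma C1_id : C1 id.
Proof. by exists (fun=> 1) => [x|x]; [exact: cvg_cst | exact: is_derive_id]. Qed.

Lemma C1D f g : C1 f -> C1 g -> C1 (f \+ g).
Proof.
move=> [f' cf df] [g' cg dg]; exists (f' \+ g') => [x|x]; first exact: cvgD (cf x) (cg x).
exact: is_deriveD.
Qed.

Lemma C1M f g : C1 f -> C1 g -> C1 (f \* g).
Proof.
move=> Cf Cg; have [f' cf df] := Cf; have [g' cg dg] := Cg.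
exists (fun x => f x *: g' x + g x *: f' x) => [x|x]; last exact: is_deriveM.
apply: cvgD; apply: cvgM => //; by [exact: C1_continuous | exact: cf | exact: cg].
Qed.

Lemma C1_comp f g : C1 f -> C1 g -> C1 (f \o g).
Proof.
move=> Cf Cg; have [f' cf df] := Cf; have [g' cg dg] := Cg.
exists (fun x => f' (g x) * g' x) => [x|x].
  apply: cvgM; last exact: cg.
  by apply: continuous_comp; [exact: C1_continuous | exact: cf].
exact: is_derive1_comp.
Qed.

Lemma is_derive_quad f (l c x : R) :
  (forall y, `|f y - f x - l * (y - x)| <= c * (y - x) ^+ 2) -> is_derive x 1 f l.
Proof.
move=> H.
have cv : h^-1 *: (f (h *: 1 + x) - f x) @[h --> 0^'] --> l.
  have c0 : 0 <= c.
    have := H (x + 1); rewrite (_ : x + 1 - x = 1); last by ring.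
    by rewrite expr1n [c * 1]mulr1; exact: le_trans.
  apply/cvgrPdist_le => e e0.
  have d0 : 0 < e / (c + 1) by rewrite divr_gt0//; lra.
  exists (e / (c + 1)) => //= h; rewrite /= sub0r normrN => he hn.
  have := H (h *: 1 + x); rewrite addrK scaler1.
  rewrite (_ : l - _ = - (h^-1 * (f (h + x) - f x - l * h))); last first.
    by rewrite /GRing.scale/=; field.
  rewrite normrN normrM normfV -real_normK ?num_real// => hh.
  rewrite mulrC ler_pdivrMr ?normr_gt0//.
  apply: (le_trans hh); rewrite expr2 mulrA ler_wpM2r//.
  have : `|h| * (c + 1) < e by rewrite -ltr_pdivlMr//; lra.
  have := normr_ge0 h; nra.
apply: DeriveDef; first by apply/cvg_ex; exists l.
by apply: cvg_lim.
Qed.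

Definition sqpos (t : R) : R := Num.max t 0 ^+ 2.

Lemma C1_sqpos : C1 sqpos.
Proof.
exists (fun x => 2 * Num.max x 0) => [x|x].
  apply: cvgMr; apply: continuous_max; [exact: cvg_id | exact: cvg_cst].
by apply: (@is_derive_quad _ _ 1) => y; rewrite mul1r; exact: pos_sqr_quad.
Qed.

Lemma C1_derive f f' : (forall x, is_derive x 1 f (f' x)) -> derive1 f = f'.
Proof. by move=> df; apply/funext => x; rewrite derive1E; have [_] := df x. Qed.

Lemma C1_derive1 f : C1 f -> (forall x, is_derive x 1 f (derive1 f x)) /\ continuous (derive1 f).
Proof. by move=> [f' cf df]; rewrite (C1_derive df). Qed.

Lemma bm_continuous f : continuous f -> bm f.
Proof.
move=> cf; split.
  exact: measurable_funTS (continuous_measurable_fun cf).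
have /compact_bounded[M [_ h]] :=
  continuous_compact (continuous_subspaceT cf) (@segment_compact R (-1) 1).
exists (M + 1) => x xI; apply: (h (M + 1)); first by rewrite ltrDl.
by exists x => //=; rewrite in_itv.
Qed.

Lemma C1_prim f : C1 f -> prim (derive1 f) f.
Proof.
move=> Cf; have [df cf'] := C1_derive1 Cf; have cf := C1_continuous Cf.
have bf' := bm_continuous cf'.
split => // x y x1; rewrite le_eqVlt => /predU1P[->|xy] y1; first by rewrite Int_xx subrr.
rewrite /Int Rintegral_itv_obnd_cbnd; last exact: bm_integrable.
rewrite /Rintegral (@continuous_FTC2 _ _ f)//.
- exact: continuous_subspaceT.
- split.
  + by move=> z _; have [] := df z.
  + exact/cvg_at_right_filter/cf.
  + exact/cvg_at_left_filter/cf.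
Qed.

Definition C1_supp (r : R) f := C1 f /\ forall x, r <= `|x| -> f x = 0.

Lemma C1_supp_test r f : r < 1 -> C1_supp r f -> test_function (D R) f.
Proof.
move=> r1 [Cf f0]; have [df cf] := C1_derive1 Cf; split; [by move=> x; have [] := df x|exact: cf|].
exists `[- r, r]%classic; split; first exact: segment_compact.
  by move=> x; rewrite /D /= !in_itv/= => /andP[? ?]; apply/andP; split; lra.
move=> x; rewrite /= in_itv/= => /negP; rewrite -ler_norml -ltNge => rx.
by apply: f0; exact: ltW.
Qed.

Lemma test_C1 f : test_function (D R) f -> C1 f.
Proof.
move=> [df cf _]; exists (derive1 f) => // x.
by apply: DeriveDef; [exact: df | rewrite derive1E].
Qed.

Lemma test_bdry f : test_function (D R) f -> f (-1) = 0 /\ f 1 = 0.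
Proof.
move=> [_ _ [K [_ KD K0]]]; split; apply: K0 => /KD.
  by rewrite /D /= in_itv/= ltxx.
by rewrite /D /= in_itv/= ltxx andbF.
Qed.

Lemma continuous_primitive k : continuous k -> (forall x, 2 <= `|x| -> k x = 0) ->
  exists2 F, (forall x, is_derive x 1 F (k x)) &
    forall x y, x <= y -> F y - F x = \int[mu]_(t in `]x, y]) k t.
Proof.
move=> ck k0.
have ik : mu.-integrable setT (EFin \o k).
  have mE : measurable (`[(-2 : R), 2]%classic : set (measurableTypeR R)) by exact: measurable_itv.
  rewrite (_ : _ \o _ = (EFin \o k) \_ `[-2, 2]).
    apply: (integrable_mkcond _ mE).1; apply: continuous_compact_integrable.
      exact: segment_compact.
    exact: continuous_subspaceT.
  apply/funext => x; rewrite restrict_EFin /= /restrict; case: ifPn => //.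
  rewrite notin_setE /= in_itv/= => /negP; rewrite -ler_norml -ltNge => h.
  by rewrite k0// ltW.
have ikS A : measurable A -> mu.-integrable A (EFin \o k) by move=> mA; apply: integrableS ik.
exists (fun x => \int[mu]_(t in `]-oo, x]) k t).
  move=> x; have [||||d1 d2] := @continuous_FTC1 R k -oo%O x (x + 1).
  - by rewrite ltrDl.
  - exact: ikS.
  - by rewrite ltNyr.
  - exact: ck.
  by apply: DeriveDef; [exact: d1 | rewrite -derive1E; exact: d2].
move=> x y xy; rewrite (@Rintegral_itvB _ k -oo%O (BRight y) x)//.
exact: ikS.
Qed.

(** * Approximation by test functions *)

(** Any primitive of [f] is constant on either side of [[-r, r]]. Mean zero makes the two constants
    equal, and subtracting their common value gives compact support. *)
Lemma primitive_supp r f : 0 <= r -> r < 1 -> C1_supp r f -> I f = 0 ->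
  exists2 F, C1_supp r F & derive1 F = f.
Proof.
move=> r0 r1 [Cf f0] If; have cf := C1_continuous Cf; have bf := bm_continuous cf.
have f2 x : 2 <= `|x| -> f x = 0 by move=> h; apply: f0; lra.
have [F0 dF0 iF0] := continuous_primitive cf f2.
have z x y : (forall t, x < t <= y -> f t = 0) -> x <= y -> F0 y = F0 x.
  move=> ft xy; apply/eqP; rewrite -subr_eq0 iF0// (@eq_Rintegral _ _ _ mu _ (fun=> 0)).
    by rewrite Rintegral_cst// mul0r.
  by move=> t; rewrite inE/= in_itv/=; exact: ft.
have neg x : x <= - r -> F0 x = F0 (- 1).
  move=> xr; have [x1|x1] := leP x (-1).
    by apply/esym/z => // t /andP[? ?]; apply: f0; rewrite ler0_norm; lra.
  by apply: z; [move=> t /andP[? ?]; apply: f0; rewrite ler0_norm; lra | exact: ltW].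
have pos1 x : r <= x -> F0 x = F0 1.
  move=> xr; have [x1|x1] := leP x 1.
    by apply/esym/z => // t /andP[? ?]; apply: f0; rewrite ger0_norm; lra.
  by apply: z; [move=> t /andP[? ?]; apply: f0; rewrite ger0_norm; lra | exact: ltW].
have e1 : F0 1 = F0 (-1) by apply/eqP; rewrite -subr_eq0 iF0; [exact/eqP | lra].
have dF x : is_derive x 1 (F0 \+ (fun=> - F0 (-1))) (f x).
  have h := @is_deriveD _ _ _ F0 (fun=> - F0 (-1)) x 1 (f x) 0 (dF0 x) (is_derive_cst _ _ _).
  by rewrite addr0 in h.
exists (F0 \+ (fun=> - F0 (-1))); last exact: C1_derive.
split; first by exists f.
move=> x /=; rewrite ler_normr => /orP[rx|rx].
  by rewrite pos1// e1 subrr.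
by rewrite neg ?subrr//; lra.
Qed.

Lemma approx_continuous f (e : R) : bm f -> 0 < e ->
  exists2 g : R -> R, continuous g & I (fun x => `|f x - g x|) <= e.
Proof.
move=> bf e0.
have fi := @bm_integrable f (-1) 1 (lexx _) (lexx _) bf.
have [||g_ [cg ig gl]] := @approximation_continuous_integrable R `](-1 : R), 1]%classic f _ _ fi.
- exact: measurable_itv.
- by rewrite /= lebesgue_measure_itv/=; case: ifP => _; rewrite ?ltry// -EFinD ltry.
have /fine_cvgP[_ /cvgrPdist_le /(_ _ e0) [n _ h]] := gl.
exists (g_ n) => //; have := h n (leqnn n).
rewrite /= sub0r normrN; apply: le_trans; exact: ler_norm.
Qed.

(** Equal to 1 on [[-1, 1]] and to 0 for [2 <= |x|]: multiplying by it makes a continuous function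
    integrable on the line, so that it can be integrated from minus infinity. *)
Definition cut (x : R) : R := Num.max 0 (Num.min 1 (2 - `|x|)).

Lemma continuous_cut : continuous cut.
Proof.
have c1 : continuous (fun x : R => Num.min 1 (2 - `|x|)).
  move=> x; apply: (@continuous_min _ _ (fun=> 1) (fun x => 2 - `|x|)).
    exact: cvg_cst.
  by apply: cvgB; [exact: cvg_cst | exact: norm_continuous].
move=> x; apply: (@continuous_max _ _ (fun=> 0) (fun x => Num.min 1 (2 - `|x|))).
  exact: cvg_cst.
exact: c1.
Qed.

Lemma cut1 x : -1 <= x <= 1 -> cut x = 1.
Proof.
rewrite -ler_norml /cut => h.
by rewrite min_l ?max_r//; lra.
Qed.

Lemma cut0 x : 2 <= `|x| -> cut x = 0.
Proof. by move=> h; rewrite /cut max_l// ge_min; apply/orP; right; lra. Qed.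

Lemma approx_C1 f F (e : R) : prim f F -> 0 < e ->
  exists2 S, C1 S & forall x, -1 <= x <= 1 -> `|F x - S x| <= e.
Proof.
move=> pF e0; have [bf Ff] := pF.
have [g cg ge] := approx_continuous bf e0.
pose k x := g x * cut x.
have ck : continuous k by move=> x; apply: cvgM; [exact: cg | exact: continuous_cut].
have k0 x : 2 <= `|x| -> k x = 0 by move=> h; rewrite /k cut0// mulr0.
have [S dS iS] := continuous_primitive ck k0.
have bk := bm_continuous ck.
have CS : C1 S by exists k.
exists (S \+ (fun=> F (-1) - S (-1))); first exact: C1D CS (C1_cst _).
move=> x /andP[x1 x2].
have -> : F x - (S \+ (fun=> F (-1) - S (-1))) x = Int (-1) x (fun t => f t - k t).
  have h1 := Ff (-1) x (lexx _) x1 x2; have h2 := iS (-1) x x1.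
  by rewrite IntD ?IntN//; [rewrite -h1 -[Int _ _ k]h2 /=; ring | exact: bmN].
have bfk : bm (fun t => f t - k t) by bmt.
have bn := bm_norm bfk.
apply: le_trans (le_normr_Rintegral _ _) _ => //; first exact: bm_integrable.
rewrite -/(Int _ _ _).
have : Int (-1) x (fun t => `|f t - k t|) <= I (fun t => `|f t - k t|).
  by rewrite [leRHS](@Int_cat _ _ x)//; rewrite lerDl; exact: Int_ge0.
move=> /le_trans; apply; rewrite (_ : I _ = I (fun x => `|f x - g x|))//.
by apply: I_ext => t /andP[? ?]; rewrite /k cut1 ?mulr1//; lra.
Qed.

(** A [C^1] cutoff composed from [sqpos]: with [v = n (1 - x^2)] it is 0 for [v <= 1] and 1 for
    [v >= 2]. *)
Definition plateau n (x : R) := 1 - sqpos (1 - sqpos (n%:R * (1 - x * x) - 1)).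

Lemma C1_plateau n : C1 (plateau n).
Proof.
have C1N f : C1 f -> C1 ((fun=> -1) \* f) by exact: C1M (C1_cst _).
have h := C1D (C1_cst 1) (C1N _ (C1_comp C1_sqpos (C1D (C1_cst 1) (C1N _
  (C1_comp C1_sqpos (C1D (C1M (C1_cst n%:R) (C1D (C1_cst 1) (C1N _ (C1M C1_id C1_id))))
  (C1_cst (-1)))))))).
move: h; congr C1; apply/funext => x.
by rewrite /plateau /= !mulN1r.
Qed.

Lemma sqpos_ge0 x : 0 <= sqpos x. Proof. exact: sqr_ge0. Qed.

Lemma plateau_itv n x : 0 <= plateau n x <= 1.
Proof.
rewrite /plateau; move: (sqpos_ge0 (n%:R * (1 - x * x) - 1)); move: (sqpos _) => a a0.
rewrite /sqpos; case: (leP (1 - a) 0) => h; first by rewrite expr0n subr0 ler01 lexx.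
apply/andP; split; nra.
Qed.

Lemma plateau_supp n : (0 < n)%N -> C1_supp (1 - (2 * n%:R)^-1) (plateau n).
Proof.
move=> n0; split; first exact: C1_plateau.
move=> x h; have n0' : 0 < n%:R :> R by rewrite ltr0n.
have n1 : 1 <= n%:R :> R by rewrite ler1n.
rewrite /plateau /sqpos (max_r (_ : n%:R * _ - 1 <= 0)).
  by rewrite expr0n subr0 max_l ?expr1n ?subrr.
set a := (2 * n%:R)^-1 in h.
have an : a * (2 * n%:R) = 1 by rewrite mulVf// mulf_neq0// gt_eqF.
have a0 : 0 < a by rewrite invr_gt0 mulr_gt0.
have a1 : a <= 1 / 2 by nra.
have hx : (1 - a) ^+ 2 <= x * x.
  by rewrite -expr2 -[x ^+ 2]real_normK ?num_real// lerXn2r// nnegrE; lra.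
have : 1 - x * x <= 2 * a by nra.
nra.
Qed.

Lemma plateau_cvg x : -1 < x < 1 -> plateau n x @[n --> \oo] --> (1 : R).
Proof.
move=> /andP[x0 x1]; apply: cvg_near_cst.
have d0 : 0 < 1 - x * x by nra.
have := nbhs_infty_ger (2 / (1 - x * x)); apply: filterS => n.
rewrite ler_pdivrMr// => h; rewrite /plateau /sqpos.
rewrite (max_l (_ : 0 <= n%:R * (1 - x * x) - 1)); last lra.
by rewrite max_r ?expr0n ?subr0//; nra.
Qed.

(** Mean zero is imposed on the approximant [w] so that its primitive is again compactly supported;
    [w] and this primitive then both serve as test functions. *)
Lemma dense_test f F (e : R) : prim f F -> I F = 0 -> 0 < e ->
  exists r w, [/\ 0 <= r, r < 1, C1_supp r w, I w = 0 & I (fun x => (F x - w x) ^+ 2) < e].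
Proof.
move=> pF IF e0; have bF := prim_bm pF; have [_ [M MF]] := bF.
have hn n : 0 < n.+1%:R^-1 :> R by rewrite invr_gt0 ltr0n.
have /choice[S_ SP] : forall n, exists S, C1 S /\
    forall x, -1 <= x <= 1 -> `|F x - S x| <= n.+1%:R^-1.
  by move=> n; have [S CS SF] := approx_C1 pF (hn n); exists S.
pose X n := plateau n.+1.
have bX n : bm (X n) by apply/bm_continuous/C1_continuous/C1_plateau.
have bS n : bm (S_ n) by apply/bm_continuous/C1_continuous; have [] := SP n.
have X1 n t : `|X n t| <= 1.
  by have /andP[X0 X1] := plateau_itv n.+1 t; rewrite ger0_norm.
have SM n t : -1 <= t <= 1 -> `|S_ n t| <= M + 1.
  move=> tI; have [_ /(_ t tI) h] := SP n.
  have := ler_normB (F t) (F t - S_ n t); rewrite opprB addrC subrK => /le_trans; apply.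
  rewrite lerD ?MF//; apply: (le_trans h); rewrite invf_le1 ?ltr0n// ler1n//.
have Xc t : -1 < t < 1 -> X n t @[n --> \oo] --> (1 : R).
  by move=> tI; rewrite /X (cvg_shiftS (fun n => plateau n t)); exact: plateau_cvg.
have Sc t : -1 < t < 1 -> S_ n t @[n --> \oo] --> F t.
  move=> /andP[t0 t1]; apply/cvgrPdist_le => d d0.
  have /cvgrPdist_le /(_ _ d0) := @cvg_harmonic R; apply: filterS => n.
  rewrite sub0r normrN ger0_norm ?(ltW (hn n))// => /(le_trans _); apply.
  by have [_] := SP n; apply; rewrite !ltW.
have c1 : I (X n) @[n --> \oo] --> (2 : R).
  have -> : 2 = I (fun=> 1) by rewrite Int_cst; lra.
  by apply: (@Int_cvg _ _ 1); rewrite ?lexx//; exact: bm_cst.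
have c2 : I (fun t => X n t * S_ n t) @[n --> \oo] --> (0 : R).
  rewrite -IF; apply: (@Int_cvg _ _ (1 * (M + 1))); rewrite ?lexx//.
  - by move=> n; exact: bmM.
  - by move=> n t tI; rewrite normrM ler_pM// SM.
  - by move=> t tI; rewrite -[F t]mul1r; apply: cvgM; [exact: Xc | exact: Sc].
have c3 : I (fun t => (F t - X n t * S_ n t) ^+ 2) @[n --> \oo] --> (0 : R).
  have -> : 0 = I (fun=> 0) by rewrite Int_cst; lra.
  apply: (@Int_cvg _ _ ((M + (M + 1)) ^+ 2)); rewrite ?lexx//.
  - exact: bm_cst.
  - by move=> n; have := bX n; have := bS n => ? ?; bmt.
  - move=> n t tI; rewrite normrX lerXn2r ?nnegrE//.
      by rewrite (le_trans _ (lerD (MF t tI) (SM n t tI)))// addr_ge0.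
    apply: le_trans (ler_normB _ _) _; rewrite lerD ?MF// normrM.
    by rewrite -[M + 1]mul1r ler_pM// SM.
  - move=> t tI; have -> : 0 = (F t - 1 * F t) ^+ 2 by rewrite mul1r subrr expr0n.
    rewrite expr2; apply: cvgM; apply: cvgB; do ?[exact: cvg_cst];
      by apply: cvgM; [exact: Xc | exact: Sc].
(* The final estimate is [2 (e / 8) + 4 c^2]. Requiring [|c| <= 1] as well turns [|c| <= e / 8] into
   [c^2 <= e / 8], for a total of [6 e / 8]. *)
have e8 : 0 < e / 8 by rewrite divr_gt0.
have q0 : 0 < Num.min 1 (e / 8) by rewrite lt_min ltr01 e8.
near \oo => n.
have h1 : 1 <= I (X n).
  have : `|2 - I (X n)| <= 1 by near: n; move/cvgrPdist_le : c1; apply.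
  by rewrite ler_norml => /andP[]; lra.
have h2 : `|0 - I (fun t => X n t * S_ n t)| <= Num.min 1 (e / 8).
  by near: n; move/cvgrPdist_le : c2; apply.
have h3 : `|0 - I (fun t => (F t - X n t * S_ n t) ^+ 2)| <= e / 8.
  by near: n; move/cvgrPdist_le : c3; apply.
(* Subtracting [c X_n] restores mean zero within the same support. The numerator tends to
   [\int F = 0] and the denominator to 2, so [c] tends to 0. *)
pose c := I (fun t => X n t * S_ n t) / I (X n).
have [CS _] := SP n.
exists (1 - (2 * n.+1%:R)^-1), (fun x => X n x * (S_ n x - c)).
have bXn := bX n; have bSn := bS n; have bc := bm_cst c.
have [CX X0] := @plateau_supp n.+1 isT.
split.
- rewrite subr_ge0 invf_le1 ?mulr_gt0 ?ltr0n//.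
  have : 1 <= n.+1%:R :> R by rewrite ler1n.
  lra.
- by rewrite ltrBlDr ltrDl invr_gt0 mulr_gt0 ?ltr0n.
- split; last by move=> x h; rewrite /X X0// mul0r.
  exact: C1M CX (C1D CS (C1_cst (- c))).
- have -> : I (fun x => X n x * (S_ n x - c)) = I (fun x => X n x * S_ n x + (- c) * X n x).
    by apply: I_ext => t _; ring.
  rewrite ID; [|bmt|bmt]; rewrite IZ// /c; field.
  by rewrite gt_eqF//; exact: lt_le_trans h1.
have cM : `|c| <= Num.min 1 (e / 8).
  move: h2; rewrite sub0r normrN /c normrM normfV => h2.
  rewrite (ger0_norm (le_trans ler01 h1)) ler_pdivrMr; last exact: lt_le_trans h1.
  by apply: (le_trans h2); rewrite ler_peMr// ltW.
have c2e : c ^+ 2 <= e / 8.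
  move: cM; rewrite le_min => /andP[ca cb]; rewrite -real_normK ?num_real// expr2.
  by apply: le_trans cb; rewrite ler_piMr.
have h4 : I (fun t => (F t - X n t * S_ n t) ^+ 2) <= e / 8.
  by apply: le_trans h3; rewrite sub0r normrN ler_norm.
apply: (@le_lt_trans _ _ (I (fun t => 2 * (F t - X n t * S_ n t) ^+ 2 + 2 * c ^+ 2))).
  apply: I_le; [bmt|bmt|] => t tI; have := X1 n t; rewrite ler_norml => /andP[? ?].
  have : 0 <= c ^+ 2 by exact: sqr_ge0.
  have : X n t ^+ 2 <= 1 by nra.
  move=> x2 cc; have : X n t ^+ 2 * c ^+ 2 <= c ^+ 2 by rewrite ler_piMl.
  have := sqr_ge0 (F t - X n t * S_ n t - X n t * c).
  lra.
rewrite ID; [|bmt|bmt]; rewrite IZ; [|bmt]; rewrite Int_cst; last lra.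
clear -h4 c2e e0; lra.
Unshelve. all: by end_near.
Qed.

(** * Weak solutions *)

Lemma prim_ibp f g F G : prim f F -> prim g G -> F (-1) = 0 -> F 1 = 0 ->
  I (fun x => f x * G x) = - I (fun x => F x * g x).
Proof.
move=> pF pG F0 F1; have bF := prim_bm pF; have bG := prim_bm pG.
have [bf _] := pF; have [bg _] := pG.
have := prim_int (primM pF pG); rewrite F0 F1 !mul0r subrr ID; [|bmt|bmt].
lra.
Qed.

(** By Cauchy-Schwarz, [F(t)^2] is at most [2 \int f^2]; integrating over length 2 gives the
    constant 4. *)
Lemma poincare f F : prim f F -> F (-1) = 0 ->
  I (fun x => F x ^+ 2) <= 4 * I (fun x => f x ^+ 2).
Proof.
move=> pF F0; have [bf Ff] := pF; have bF := prim_bm pF; have bn := bm_norm bf.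
have b1 := bm_cst 1.
have := inner_cs (L2_bm bn) (L2_bm b1); rewrite !inner_bm//.
have -> : I (fun x => 1 * 1) = 2 by rewrite Int_cst; lra.
have -> : I (fun x => `|f x| * `|f x|) = I (fun x => f x ^+ 2).
  by apply: I_ext => t _; rewrite -expr2 real_normK ?num_real.
set a := I (fun x => _ * 1) => cs.
have Fa t : -1 < t <= 1 -> F t ^+ 2 <= a ^+ 2.
  move=> /andP[t0 t1].
  have -> : F t = Int (-1) t f by rewrite -Ff ?F0 ?subr0 ?lexx// ltW.
  rewrite -real_normK ?num_real// lerXn2r// ?nnegrE.
    by apply: I_ge0 => x _; rewrite mulr1.
  apply: le_trans (le_normr_Rintegral _ _) _ => //; first exact: bm_integrable.
  rewrite -/(Int _ _ _) /a (_ : I _ = I (fun x => `|f x|)); last first.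
    by apply: I_ext => x _; rewrite mulr1.
  rewrite [leRHS](@Int_cat _ _ t)//; [|exact: ltW].
  by rewrite lerDl; exact: Int_ge0.
apply: (@le_trans _ _ (I (fun=> a ^+ 2))).
  by apply: I_le => //; bmt.
rewrite Int_cst; last lra.
move: (I _) cs => J cs; lra.
Qed.

Lemma sqr_small_eq0 (x K : R) : 0 <= K -> (forall e, 0 < e -> x ^+ 2 <= e * K) -> x = 0.
Proof.
move=> K0 H; apply/eqP; rewrite -sqrf_eq0 eq_le sqr_ge0 andbT leNgt; apply/negP => x0.
have e0 : 0 < x ^+ 2 / (2 * (K + 1)) by rewrite divr_gt0//; lra.
have := H _ e0; rewrite mulrAC ler_pdivlMr; last lra.
nra.
Qed.

Lemma sqr_add_le (a b A B : R) : a ^+ 2 <= A -> b ^+ 2 <= B -> (a + b) ^+ 2 <= 2 * (A + B).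
Proof. by move=> *; have := sqr_ge0 (a - b); lra. Qed.

Lemma inner_sqr_ge0 f : 0 <= inner (D R) f f.
Proof. by apply: Rintegral_ge0 => x _; rewrite -expr2 sqr_ge0. Qed.

Lemma inner_bm_sqr f : bm f -> inner (D R) f f = I (fun x => f x ^+ 2).
Proof. by move=> bf; rewrite inner_bm//; apply: I_ext => t _; rewrite -expr2. Qed.

(* A weak second derivative is only tested against smooth functions; approximating
   [T] in [L^2] by test functions of mean zero extends this to the kernel [V]. *)
Lemma weak_pairing u h th T V : W120 (D R) u -> second_weak_derivative (D R) u h ->
  prim th T -> prim T V -> V (-1) = 0 -> V 1 = 0 ->
  inner (D R) u th = inner (D R) h V.
Proof.
move=> [g1 [Lu Lg1 wg1] dens] [g [_ Lg wg] [_ Lh wh]] pT pV V0 V1.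
have [bth _] := pT; have bT := prim_bm pT; have bV := prim_bm pV.
(* [T] need not vanish at the ends, so the Dirichlet condition on [u] must enter: test functions
   close to [u] carry no boundary term when integrated by parts against [T]. *)
have step1 : inner (D R) u th = - inner (D R) g1 T.
  apply/eqP; rewrite -addr_eq0; apply/eqP.
  apply: (@sqr_small_eq0 _ (2 * (inner (D R) th th + inner (D R) T T))).
    by rewrite mulr_ge0// addr_ge0// inner_sqr_ge0.
  move=> e /dens[phi tphi lte].
  have pphi := C1_prim (test_C1 tphi); have [phi0 phi1] := test_bdry tphi.
  have [bphi' _] := pphi; have bphi := prim_bm pphi.
  have i1 := innerBl Lu (L2_bm bphi) (L2_bm bth).
  have i2 := innerBl Lg1 (L2_bm bphi') (L2_bm bT).
  have := prim_ibp pphi pT phi0 phi1; rewrite -!inner_bm// => i3.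
  have -> : inner (D R) u th + inner (D R) g1 T =
      inner (D R) (u \- phi) th + inner (D R) (g1 \- derive1 phi) T by rewrite i1 i2 i3; ring.
  have L1 := L2B Lu (L2_bm bphi); have L2' := L2B Lg1 (L2_bm bphi').
  apply: le_trans (sqr_add_le (inner_cs L1 (L2_bm bth)) (inner_cs L2' (L2_bm bT))) _.
  have := inner_sqr_ge0 (u \- phi); have := inner_sqr_ge0 (g1 \- derive1 phi).
  have := inner_sqr_ge0 th; have := inner_sqr_ge0 T.
  move: lte; move: (inner _ _ _) (inner _ _ _) (inner _ _ _) (inner _ _ _) => a b c d.
  clear; nra.
rewrite step1; apply/eqP; rewrite eq_sym -addr_eq0; apply/eqP.
have IT : I T = 0 by rewrite (prim_int pV) V0 V1 subrr.
apply: (@sqr_small_eq0 _ (2 * (inner (D R) g1 g1 + 4 * inner (D R) h h))).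
  by rewrite mulr_ge0// addr_ge0 ?inner_sqr_ge0// mulr_ge0// inner_sqr_ge0.
move=> e e0; have [r [w [r0 r1 Cw Iw Tw]]] := dense_test pT IT e0.
have [phi Cphi dphi] := primitive_supp r0 r1 Cw Iw.
have tw := C1_supp_test r1 Cw; have tphi := C1_supp_test r1 Cphi.
have [phi0 phi1] := test_bdry tphi.
have pphi := C1_prim (test_C1 tphi); rewrite dphi in pphi.
have bw := prim_bm (C1_prim (test_C1 tw)); have bphi := prim_bm pphi.
(* [g1] comes from [W120] and [g] from the second derivative; as weak derivatives of the same [u]
   they agree against the test function [w]. *)
have i1 : inner (D R) g1 w = - inner (D R) h phi.
  rewrite -[LHS]opprK -wg1// wg// opprK.
  by rewrite -[in LHS]dphi wh.
have j1 := innerBl (L2_bm bT) (L2_bm bw) Lg1.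
have j2 := innerBl (L2_bm bV) (L2_bm bphi) Lh.
have sym f f' : inner (D R) f f' = inner (D R) f' f.
  by apply: eq_Rintegral => x _; rewrite mulrC.
have -> : inner (D R) h V + inner (D R) g1 T =
    inner (D R) (V \- phi) h + inner (D R) (T \- w) g1.
  by rewrite j1 j2 [inner _ w g1]sym i1 [inner _ phi h]sym [inner _ V h]sym [inner _ T g1]sym; ring.
have L1 := L2B (L2_bm bV) (L2_bm bphi); have L2' := L2B (L2_bm bT) (L2_bm bw).
apply: le_trans (sqr_add_le (inner_cs L1 Lh) (inner_cs L2' Lg1)) _.
have pd : prim (T \- w) (V \- phi).
  by apply: prim_ext (primD pV (primZ (-1) pphi)) _ _ => x _; rewrite mulN1r.
have := poincare pd; rewrite /= V0 phi0 subrr => /(_ erefl).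
have [bd _] := pd; have bd' := prim_bm pd.
rewrite -!inner_bm_sqr//.
move: Tw; rewrite -inner_bm_sqr// => Tw.
have := inner_sqr_ge0 (V \- phi); have := inner_sqr_ge0 (T \- w).
have := inner_sqr_ge0 h; have := inner_sqr_ge0 g1.
move: Tw; move: (inner _ _ _) (inner _ _ _) (inner _ _ _) (inner _ _ _) => a b c d.
clear; nra.
Qed.

Definition side A x : R := \1_A x - \1_(D R `\` A) x.

Lemma bm_indic A : measurable (A : set (measurableTypeR R)) -> bm \1_A.
Proof.
move=> mA; split; first exact: measurable_indic.
by exists 1 => x _; rewrite indicE; case: (_ \in _); rewrite ?normr1 ?normr0.
Qed.

Lemma measurable_open A : open A -> measurable (A : set (measurableTypeR R)).
Proof. exact: open_measurable. Qed.

Lemma measurable_DC A : measurable (A : set (measurableTypeR R)) ->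
  measurable (D R `\` A : set (measurableTypeR R)).
Proof. by move=> mA; apply: measurableD => //; exact: measurable_itv. Qed.

Lemma side_in A x : A x -> side A x = 1.
Proof.
move=> Ax; rewrite /side !indicE mem_set// memNset ?subr0//.
by move=> [_]; apply.
Qed.

Lemma side_out A x : D R x -> ~ A x -> side A x = -1.
Proof.
move=> Dx nAx; rewrite /side !indicE memNset// mem_set ?sub0r//.
Qed.

Lemma side_norm A x : -1 < x < 1 -> `|side A x| = 1.
Proof.
move=> xI; have Dx : D R x by rewrite /D /= in_itv.
have [Ax|nAx] := pselect (A x); first by rewrite side_in// normr1.
by rewrite side_out// normrN1.
Qed.

Lemma bm_side A : open A -> bm (side A).
Proof.
move=> /measurable_open mA; have := bm_indic mA; have := bm_indic (measurable_DC mA).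
by move=> ? ?; rewrite /side; bmt.
Qed.

Lemma inner_ae_ext f g k : L2 (D R) f -> bm g -> bm k ->
  (\forall x \ae mu, D R x -> f x = g x) -> inner (D R) f k = inner (D R) g k.
Proof.
move=> Lf bg bk fg; rewrite /inner /Rintegral; congr fine.
have mD : measurable (D R : set (measurableTypeR R)) by exact: measurable_itv.
apply: ae_eq_integral => //.
- by have /integrableP[] := L2_integrable Lf (L2_bm bk).
- by have /integrableP[] := L2_integrable (L2_bm bg) (L2_bm bk).
by apply: ae_imp fg => x /[apply] ->.
Qed.

Lemma inner_sym f g : inner (D R) f g = inner (D R) g f.
Proof. by apply: eq_Rintegral => x _; rewrite mulrC. Qed.

Section Solutions.
Variables (A : set R) (lam : R).
Hypothesis oA : open A.
Let h x := lam + side A x.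
Let bh : bm h.
Proof. by have := bm_side oA => ?; rewrite /h; bmt. Qed.

Lemma dirichlet_exists : exists G U, [/\ prim h G, prim G U, U (-1) = 0 & U 1 = 0].
Proof.
pose G0 x := 0 + Int (-1) x h.
have pG0 : prim h G0 by exact: primI.
have bG0 := prim_bm pG0.
(* The initial slope that gives [G] mean zero over length 2, hence [U(1) = 0]. *)
pose c := - I G0 / 2.
have pG : prim h (fun x => G0 x + c).
  by apply: prim_ext (primD pG0 (prim_cst c)) _ _ => // x _; rewrite addr0.
have bG := prim_bm pG.
exists (fun x => G0 x + c), (fun x => 0 + Int (-1) x (fun x => G0 x + c)); split => //.
- exact: primI.
- by rewrite Int_xx addr0.
- rewrite add0r ID//; last exact: bm_cst.
  by rewrite Int_cst /c; [field | lra].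
Qed.

(** Uniqueness by duality: [k] is written as [V''] with [V] vanishing at the ends, and both
    derivatives are moved across. Testing against every bounded [k] replaces a pointwise
    identification of [u] with [U]. *)
Lemma solution_pairing u G U k : solution A lam u -> prim h G -> prim G U ->
  U (-1) = 0 -> U 1 = 0 -> bm k -> inner (D R) u k = I (fun x => U x * k x).
Proof.
move=> [Wu _ [h' sw h'E]] pG pU U0 U1 bk.
pose T0 x := 0 + Int (-1) x k.
have pT0 : prim k T0 by exact: primI.
pose c := - I T0 / 2.
have pT : prim k (fun x => T0 x + c).
  by apply: prim_ext (primD pT0 (prim_cst c)) _ _ => // x _; rewrite addr0.
have bT0 := prim_bm pT0; have bT := prim_bm pT.
pose V x := 0 + Int (-1) x (fun x => T0 x + c).
have pV : prim (fun x => T0 x + c) V by exact: primI.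
have V0 : V (-1) = 0 by rewrite /V Int_xx addr0.
have V1 : V 1 = 0.
  rewrite /V add0r ID//; last exact: bm_cst.
  by rewrite Int_cst /c; [field | lra].
have bV := prim_bm pV.
rewrite (weak_pairing Wu sw pT pV V0 V1).
have Lh' : L2 (D R) h' by have [g _ []] := sw.
rewrite (inner_ae_ext Lh' bh bV); last first.
  by apply: ae_imp h'E => x /[apply] ->; rewrite /h /side addrA.
rewrite inner_bm// -(opprK (I (fun x => U x * k x))) -(prim_ibp pU pT U0 U1).
have := prim_ibp pV pG V0 V1.
rewrite (_ : I (fun x => V x * h x) = I (fun x => h x * V x)); last first.
  by apply: I_ext => t _; rewrite mulrC.
rewrite (_ : I (fun x => (T0 x + c) * G x) = I (fun x => G x * (T0 x + c))); last first.
  by apply: I_ext => t _; rewrite mulrC.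
by move=> ->; rewrite opprK.
Qed.

Lemma prim_weak_derivative f F : prim f F -> weak_derivative (D R) F f.
Proof.
move=> pF; have bF := prim_bm pF; have [bf _] := pF.
split; [exact: L2_bm|exact: L2_bm|move=> phi tphi].
have pphi := C1_prim (test_C1 tphi); have [phi0 phi1] := test_bdry tphi.
have [bphi' _] := pphi; have bphi := prim_bm pphi.
rewrite inner_sym [in RHS]inner_sym !inner_bm//.
exact: prim_ibp pphi pF phi0 phi1.
Qed.

Lemma prim_W120 G U : prim h G -> prim G U -> U (-1) = 0 -> U 1 = 0 -> W120 (D R) U.
Proof.
move=> pG pU U0 U1; exists G; first exact: prim_weak_derivative.
move=> e e0; have IG : I G = 0 by rewrite (prim_int pU) U0 U1 subrr.
(* One share for the derivatives and, by [poincare], four for the functions. *)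
have e5 : 0 < e / 5 by rewrite divr_gt0.
have [r [w [r0 r1 Cw Iw Gw]]] := dense_test pG IG e5.
have [phi Cphi dphi] := primitive_supp r0 r1 Cw Iw.
have tphi := C1_supp_test r1 Cphi; exists phi => //.
have [phi0 _] := test_bdry tphi.
have pphi := C1_prim (test_C1 tphi); rewrite dphi in pphi *.
have pd : prim (G \- w) (U \- phi).
  by apply: prim_ext (primD pU (primZ (-1) pphi)) _ _ => x _; rewrite mulN1r.
have := poincare pd; rewrite /= U0 phi0 subrr => /(_ erefl).
have [bd _] := pd; have bd' := prim_bm pd.
rewrite !inner_bm_sqr// => hp.
move: Gw hp; rewrite /=; move: (I _) (I _) => a b; lra.
Qed.

End Solutions.

Lemma prim_ae_ext f g F : prim f F -> bm g ->
  (\forall x \ae mu, -1 < x < 1 -> f x = g x) -> prim g F.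
Proof.
move=> [bf Ff] bg fg; split=> // x y x1 xy y1; rewrite Ff//; apply: Int_ae_ext => //.
by apply: ae_imp fg => t h /andP[? ?]; apply: h; lra.
Qed.

Definition agrees (s : R -> R) A := \forall x \ae mu, -1 < x < 1 -> s x = side A x.

Lemma state_feasible lam s G U A : open A -> A `<=` D R -> is_state lam s G U ->
  agrees s A -> feasible lam A U /\ objective A U = (energy G / 2)%:E.
Proof.
move=> oA AD st sA; have [bs s1 pG pU [U0 U1 IU]] := st.
have bsA := bm_side oA.
have pG' : prim (fun x => lam + side A x) G.
  apply: prim_ae_ext pG _ _; first by have := bm_cst lam => ?; bmt.
  by apply: ae_imp sA => x /[apply] ->.
have bU := prim_bm pU.
have sw : second_weak_derivative (D R) U (fun x => lam + side A x).
  by exists G; exact: prim_weak_derivative.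
split.
  split => //; last first.
    rewrite inner_bm//; last exact: bm_cst.
    by apply: etrans IU; apply: I_ext => t _; rewrite mulr1.
  split; [exact: prim_W120 pG' pU U0 U1|by exists (fun x => lam + side A x)|].
  exists (fun x => lam + side A x) => //.
  by apply: aeW => x _; rewrite /side addrA.
rewrite /objective; congr (_%:E).
have mDA := measurable_DC (measurable_open oA); have bi := bm_indic mDA.
rewrite inner_bm//.
(* On [D] the indicator of the complement of [A] is [(1 - side A) / 2]; at the endpoint 1, outside
   [D], the factor [U] vanishes. *)
have -> : I (fun x => \1_(D R `\` A) x * U x) =
    I (fun x => 1 / 2 * U x + (- (1 / 2)) * (side A x * U x)).
  apply: I_ext => t; rewrite le_eqVlt => /andP[t0 /predU1P[->|t1]].
    by rewrite U1 !mulr0 addr0.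
  have Dt : D R t by rewrite /D /= in_itv/= t0.
  have [At|nAt] := pselect (A t).
    by rewrite side_in// indicE memNset ?mul0r; [ring | move=> []].
  rewrite side_out// indicE (mem_set (conj Dt nAt : (D R `\` A) t)) /=; by field.
rewrite ID; [|bmt|bmt]; rewrite !IZ; [|bmt|bmt].
have -> : I (fun x => side A x * U x) = - energy G.
  rewrite (energyE st) opprK.
  rewrite (_ : I (fun x => (lam + s x) * U x) = lam * I U + I (fun x => side A x * U x)).
    by rewrite IU mulr0 add0r.
  rewrite -IZ// -ID; [|by bmt|by bmt].
  apply: Int_ae_ext; rewrite ?lexx//; [by have := bm_cst lam => ?; bmt|by bmt|].
  by apply: ae_imp sA => x /[apply] ->; ring.
by rewrite IU; field.
Qed.

(** The constraint and the objective see [u] only through pairings with bounded functions, so the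
    classical solution can take its place. *)
Lemma feasible_state lam A u : feasible lam A u -> exists G U,
  is_state lam (side A) G U /\ objective A u = (energy G / 2)%:E.
Proof.
move=> [oA AD su u1].
have [G [U [pG pU U0 U1]]] := dirichlet_exists lam oA.
have pair := solution_pairing oA su pG pU U0 U1.
have IU : I U = 0.
  rewrite -[RHS]u1 pair; last exact: bm_cst.
  by apply: I_ext => t _; rewrite mulr1.
have st : is_state lam (side A) G U.
  by split => //; [exact: bm_side | move=> x; exact: side_norm].
exists G, U; split => //.
have ag : agrees (side A) A by apply: aeW.
have [_ <-] := state_feasible oA AD st ag.
have bU := prim_bm pU.
have bi := bm_indic (measurable_DC (measurable_open oA)).
rewrite /objective inner_sym pair// inner_bm//; congr (_%:E).
by apply: I_ext => t _; rewrite mulrC.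
Qed.

(** * The end sets *)

Section EndState.
Variables (xi sg : R).
Hypotheses (xi1 : -1 < xi < 1) (sgE : sg = 1 \/ sg = -1).
Let lam := (3 * xi - xi ^+ 3) / 2.
Let z x := sg * x + 1.
Let w x := sg * x - xi.
Let y := pos w.
(** The slope that makes [end_U] vanish at the far end [z = 2]. The sign [sg] treats an end set and
    its reflection together, with [z] the distance from the end outside the set and [y] the depth
    beyond the interface. *)
Let al := (1 - lam) - (1 - xi) ^+ 2 / 2.

Definition end_side x := 2 * ind w x - 1.
Definition end_G x := sg * (al + (lam - 1) * z x + 2 * y x).
Definition end_U x := al * z x + (lam - 1) / 2 * z x ^+ 2 + y x ^+ 2.

Let sg2 : sg * sg = 1.
Proof. by case: sgE => ->; ring. Qed.

Let pz : prim (fun=> sg) z.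
Proof.
apply: prim_ext (primD (primZ sg prim_id) (prim_cst 1)) _ _ => x _ //.
by rewrite mulr1 addr0.
Qed.

Let pw : prim (fun=> sg) w.
Proof.
apply: prim_ext (primD (primZ sg prim_id) (prim_cst (- xi))) _ _ => x _ //.
by rewrite mulr1 addr0.
Qed.

Let py : prim (fun x => ind w x * sg) y.
Proof. exact: prim_pos pw. Qed.

Let iy x : ind w x * y x = y x.
Proof. by rewrite /y /pos /ind; case: ltP; rewrite ?mul1r ?mulr0. Qed.

Let bi : bm (ind w). Proof. exact: bm_ind (prim_bm pw). Qed.
Let by_ : bm y. Proof. exact: prim_bm py. Qed.

Let y_ends : (y 1 = (1 + sg) / 2 * (1 - xi)) /\ (y (-1) = (1 - sg) / 2 * (1 - xi)).
Proof.
have /andP[? ?] := xi1.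
rewrite /y /pos /w; case: sgE => ->.
  by rewrite max_l ?max_r; [split; field | lra | lra].
by rewrite max_r ?max_l; [split; field | lra | lra].
Qed.

Let pU : prim end_G end_U.
Proof.
have p2 := primD (primZ al pz) (primD (primZ ((lam - 1) / 2) (primM pz pz)) (primM py py)).
apply: prim_ext p2 _ _ => x _; rewrite /end_U /end_G; last by ring.
rewrite [ind w x * sg * y x]mulrAC [y x * _]mulrA [y x * ind w x]mulrC iy.
by field.
Qed.

Let pG : prim (fun x => lam + end_side x) end_G.
Proof.
have p1 := primZ sg (primD (primZ (lam - 1) pz) (primZ 2 py)).
have p2 := primD (prim_cst (sg * al)) p1.
apply: prim_ext p2 _ _ => x _; rewrite /end_side /end_G; last by ring.
transitivity (sg * sg * ((lam - 1) + 2 * ind w x)); first by ring.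
by rewrite sg2; ring.
Qed.

Let bU : bm end_U. Proof. exact: prim_bm pU. Qed.

Let U0 : end_U (-1) = 0.
Proof.
rewrite /end_U; have [_ ->] := y_ends; rewrite /z /al.
by case: sgE => ->; field.
Qed.

Let U1 : end_U 1 = 0.
Proof.
rewrite /end_U; have [-> _] := y_ends; rewrite /z /al.
by case: sgE => ->; field.
Qed.

(** With the boundary values settled by [al], zero mean amounts to the cubic relation between [lam]
    and [xi]. *)
Let IU : I end_U = 0.
Proof.
have p1 := primD (primZ (al / 2) (primM pz pz)) (primD
  (primZ ((lam - 1) / 6) (primM pz (primM pz pz))) (primZ (1 / 3) (primM py (primM py py)))).
have h := prim_int (primZ sg p1).
have [y1 y0] := y_ends; rewrite y1 y0 in h.
have e : I end_U = sg * (al / 2 * (z 1 * z 1) +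
    ((lam - 1) / 6 * (z 1 * (z 1 * z 1)) +
     1 / 3 * ((1 + sg) / 2 * (1 - xi) * ((1 + sg) / 2 * (1 - xi) * ((1 + sg) / 2 * (1 - xi)))))) -
 sg * (al / 2 * (z (-1) * z (-1)) +
   ((lam - 1) / 6 * (z (-1) * (z (-1) * z (-1))) +
    1 / 3 * ((1 - sg) / 2 * (1 - xi) * ((1 - sg) / 2 * (1 - xi) * ((1 - sg) / 2 * (1 - xi)))))).
  rewrite -h; apply: I_ext => t _.
  transitivity (sg * sg * (al * z t + (lam - 1) / 2 * z t ^+ 2 + (ind w t * y t) * y t)).
    by rewrite sg2 mul1r iy /end_U; ring.
  by field.
by rewrite e /z /al /lam; case: sgE => ->; field.
Qed.

Lemma end_state : is_state lam end_side end_G end_U.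
Proof.
have bs : bm end_side by rewrite /end_side; bmt.
split => // x _; rewrite /end_side /ind; case: ifP => _.
  by rewrite mulr1 (_ : 2 - 1 = 1) ?normr1//; ring.
by rewrite mulr0 sub0r normrN1.
Qed.

Lemma end_energy : energy end_G = (1 - xi ^+ 2) ^+ 3 / 6.
Proof.
rewrite (energyE end_state).
have -> : I (fun x => (lam + end_side x) * end_U x) =
    (lam - 1) * I end_U + 2 * I (fun x => ind w x * end_U x).
  rewrite -!IZ//; last by bmt.
  by rewrite -ID; [|bmt|bmt]; apply: I_ext => t _; rewrite /end_side; ring.
(* Taylor coefficients of [end_U] at the interface: on [0 < w] it is [p0 + p1 y + p2 y^2]. *)
pose p0 := al * (1 + xi) + (lam - 1) / 2 * (1 + xi) ^+ 2.
pose p1 := al + (lam - 1) * (1 + xi).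
pose p2 := (lam + 1) / 2.
have pr := primZ sg (primD (primZ p0 py) (primD (primZ (p1 / 2) (primM py py))
  (primZ (p2 / 3) (primM py (primM py py))))).
have h := prim_int pr.
have [y1 y0] := y_ends; rewrite y1 y0 in h.
rewrite IU mulr0 add0r.
rewrite (_ : I (fun x => ind w x * end_U x) = sg *
    (p0 * ((1 + sg) / 2 * (1 - xi)) +
     (p1 / 2 * ((1 + sg) / 2 * (1 - xi) * ((1 + sg) / 2 * (1 - xi))) +
      p2 / 3 *
      ((1 + sg) / 2 * (1 - xi) *
       ((1 + sg) / 2 * (1 - xi) * ((1 + sg) / 2 * (1 - xi)))))) -
    sg *
    (p0 * ((1 - sg) / 2 * (1 - xi)) +
     (p1 / 2 * ((1 - sg) / 2 * (1 - xi) * ((1 - sg) / 2 * (1 - xi))) +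
      p2 / 3 *
      ((1 - sg) / 2 * (1 - xi) *
       ((1 - sg) / 2 * (1 - xi) * ((1 - sg) / 2 * (1 - xi))))))).
  by rewrite /p0 /p1 /p2 /al /lam; case: sgE => ->; field.
rewrite -h; apply: I_ext => t _.
transitivity (sg * sg * (ind w t * (p0 + p1 * y t + p2 * y t ^+ 2))); last by field.
rewrite sg2 mul1r /end_U; rewrite /y /pos /ind /p0 /p1 /p2.
case: ltP => wt; last by rewrite !mul0r.
rewrite !mul1r; have -> : z t = w t + (1 + xi) by rewrite /z /w; ring.
by field.
Qed.

End EndState.

(** * The two optimisation problems *)

Lemma null_eqP A B : measurable (A : set (measurableTypeR R)) ->
  measurable (B : set (measurableTypeR R)) -> A `<=` D R -> B `<=` D R ->
  null_eq A B <-> \forall x \ae mu, -1 < x < 1 -> (A x <-> B x).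
Proof.
move=> mA mB AD BD.
have mAB : measurable (A `+` B : set (measurableTypeR R)).
  by rewrite /setY; apply: measurableU; exact: measurableD.
split => [AB0|[N [mN N0 AN]]].
  exists (A `+` B); split => // x nAB; apply: contrapT => nx; apply: nAB => _.
  split => [Ax|Bx]; apply: contrapT => h; apply: nx; rewrite /setY; by [left|right].
apply/eqP; rewrite eq_le measure_ge0 andbT -N0; apply: le_measure; rewrite ?inE//.
move=> x; rewrite /setY => ABx; apply: AN => /= h.
have Dx : D R x by case: ABx => [[/AD]|[/BD]].
have : A x <-> B x by apply: h; rewrite /D /= in_itv in Dx.
by case: ABx => -[] ? ?; tauto.
Qed.

Definition half (xi sg : R) : set R := [set x | D R x /\ xi < sg * x].

Lemma half1 xi : -1 < xi < 1 -> half xi 1 = `]xi, 1[%classic.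
Proof.
move=> /andP[x0 x1]; apply/seteqP; split => x; rewrite /half /D /= !in_itv/= mul1r.
  by move=> [/andP[_ ->] ->].
by move=> /andP[h ->]; split => //; rewrite andbT; exact: lt_trans h.
Qed.

Lemma halfN1 xi : -1 < xi < 1 -> half xi (-1) = `]-1, - xi[%classic.
Proof.
move=> /andP[x0 x1]; apply/seteqP; split => x; rewrite /half /D /= !in_itv/= mulN1r ltrNr.
  by move=> [/andP[-> _] ->].
by move=> /andP[h0 h]; split => //; apply/andP; split; lra.
Qed.

Lemma half_open xi sg : -1 < xi < 1 -> sg = 1 \/ sg = -1 -> open (half xi sg).
Proof.
move=> xi1 [->|->]; first by rewrite half1//; exact: itv_open.
by rewrite halfN1//; exact: itv_open.
Qed.

Lemma half_sub xi sg : half xi sg `<=` D R.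
Proof. by move=> x []. Qed.

Lemma end_side_half xi sg x : -1 < x < 1 -> end_side xi sg x = side (half xi sg) x.
Proof.
move=> xI; have Dx : D R x by rewrite /D /= in_itv.
rewrite /end_side /ind subr_gt0; case: ifPn => h.
  by rewrite side_in//; ring.
rewrite side_out//; first by ring.
by case=> _; exact/negP.
Qed.

Section Fixed.
Variable xi : R.
Hypothesis xi1 : -1 < xi < 1.
Let lam := (3 * xi - xi ^+ 3) / 2.
Let V := (1 - xi ^+ 2) ^+ 3 / 12.

Lemma half_feasible sg A : sg = 1 \/ sg = -1 -> open A -> A `<=` D R ->
  null_eq A (half xi sg) -> exists u, feasible lam A u /\ objective A u = V%:E.
Proof.
have mh : sg = 1 \/ sg = -1 -> measurable (half xi sg : set (measurableTypeR R)).
  by move=> sgE; apply: measurable_open; exact: half_open.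
move=> sgE oA AD /(null_eqP (measurable_open oA) (mh sgE) AD (@half_sub _ _)) AE.
have st := end_state xi1 sgE.
have ag : agrees (end_side xi sg) A.
  apply: ae_imp AE => x h xI; rewrite end_side_half//.
  have [hx|nhx] := pselect (half xi sg x).
    by rewrite !side_in//; exact/(h xI).
  have Dx : D R x by rewrite /D /= in_itv.
  by rewrite !side_out// => /(h xI).
exists (end_U xi sg); have [fe ->] := state_feasible oA AD st ag.
split => //; congr (_%:E); by rewrite (end_energy xi1 sgE) /V; field.
Qed.

Lemma feasible_le A u : feasible lam A u -> (objective A u <= V%:E)%E.
Proof.
move=> /feasible_state[G [U [st ->]]]; rewrite lee_fin /V.
have := energy_le st xi1 erefl; lra.
Qed.

Lemma feasible_eq A u : feasible lam A u -> objective A u = V%:E ->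
  null_eq A `]xi, 1[%classic \/ null_eq A `]-1, - xi[%classic.
Proof.
move=> fe; have [oA AD _ _] := fe.
have [G [U [st ->]]] := feasible_state fe => -[EV].
have EV' : energy G = (1 - xi ^+ 2) ^+ 3 / 6 by move: EV; rewrite /V; lra.
have sideP x : D R x -> (side A x = 1 -> A x) /\ (side A x = -1 -> ~ A x).
  move=> Dx; split => [h|h Ax].
    apply: contrapT => nAx; move: h; rewrite side_out// => /eqP.
    by rewrite eq_sym -addr_eq0 -(natrD _ 1 1) pnatr_eq0.
  by move: h; rewrite side_in// => /eqP; rewrite -addr_eq0 -(natrD _ 1 1) pnatr_eq0.
have sub1 : `]xi, 1[%classic `<=` D R by rewrite -half1//; exact: half_sub.
have sub2 : `]-1, - xi[%classic `<=` D R by rewrite -halfN1//; exact: half_sub.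
have /andP[xi0 xi2] := xi1.
have [h|h] := rigidity st xi1 erefl EV'; [left | right].
  apply/(null_eqP (measurable_open oA) _ AD sub1); first exact: measurable_itv.
  apply: ae_imp2 (ae_neq xi) h => x xn hx xI.
  have [h1 h2] := hx xI; have [|s1 s2] := sideP x; first by rewrite /D /= in_itv.
  rewrite /= in_itv/=; case/andP: (xI) => x0 ->; rewrite andbT.
  have [xlt|xgt|xe] := ltgtP x xi; last by rewrite xe eqxx in xn.
    by split => // /(s2 (h1 xlt)).
  by split => // _; exact/s1/h2.
apply/(null_eqP (measurable_open oA) _ AD sub2); first exact: measurable_itv.
apply: ae_imp2 (ae_neq (- xi)) h => x xn hx xI.
have [h1 h2] := hx xI; have [|s1 s2] := sideP x; first by rewrite /D /= in_itv.
rewrite /= in_itv/=; case/andP: (xI) => -> x2 /=.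
have [xlt|xgt|xe] := ltgtP x (- xi); last by rewrite xe eqxx in xn.
  by split => // _; exact/s1/h1.
by split => // /(s2 (h2 xgt)).
Qed.

Lemma null_eq_refl (A : set R) : null_eq A A.
Proof. by rewrite /null_eq setYK measure0. Qed.

Lemma gamma_atE : gamma_at lam = V%:E.
Proof.
apply/eqP; rewrite eq_le; apply/andP; split.
  by apply: ge_ereal_sup => _ [A [u [fe <-]]]; exact: feasible_le.
apply: ereal_sup_ubound.
have sgE : (1 : R) = 1 \/ (1 : R) = -1 by left.
have [u [fe ou]] := half_feasible sgE (half_open xi1 sgE) (@half_sub _ _) (null_eq_refl (half _ 1)).
by exists (half xi 1), u.
Qed.

Lemma optimal_atE A : open A -> A `<=` D R ->
  optimal_at lam A <-> null_eq A `]xi, 1[%classic \/ null_eq A `]-1, - xi[%classic.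
Proof.
move=> oA AD; split => [[u fe]|]; first by rewrite gamma_atE; exact: feasible_eq.
rewrite -half1// -halfN1// => -[|] h.
  have [|u [fe ou]] := half_feasible _ oA AD h; first by left.
  by exists u; rewrite ?gamma_atE.
have [|u [fe ou]] := half_feasible _ oA AD h; first by right.
by exists u; rewrite ?gamma_atE.
Qed.

(** The right-hand side is [(1 - lam) / 3], which identifies the parameter [xi] of the cubic with
    the point defining the end set. *)
Lemma varphiE : varphi xi = (2 - 3 * xi + xi ^+ 3) / 6.
Proof.
have /andP[xi0 xi2] := xi1; have bp := bm_psi.
pose w x := x - xi.
have pw : prim (fun=> 1) w := prim_sub_cst xi prim_id.
have py := prim_pos pw; have bi := bm_ind (prim_bm pw).
have pr := primD (primZ ((1 - xi ^+ 2) / 2) py) (primD (primZ (- xi / 2) (primM py py))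
  (primZ (- (1 / 6)) (primM py (primM py py)))).
have h := prim_int pr.
rewrite /varphi inner_bm//; last by apply: bm_indic; exact: measurable_itv.
have y1 : pos w 1 = 1 - xi by rewrite /pos /w max_l//; lra.
have y0 : pos w (-1) = 0 by rewrite /pos /w max_r//; lra.
rewrite y1 y0 in h.
transitivity ((1 - xi ^+ 2) / 2 * (1 - xi) +
    (- xi / 2 * ((1 - xi) * (1 - xi)) +
     - (1 / 6) * ((1 - xi) * ((1 - xi) * (1 - xi)))) -
    ((1 - xi ^+ 2) / 2 * 0 +
     (- xi / 2 * (0 * 0) + - (1 / 6) * (0 * (0 * 0))))); last by field.
rewrite -h; apply: I_ext => t /andP[t0 t1].
rewrite indicE /pos /ind /w subr_gt0; case: ltP => xt; last first.
  by rewrite memNset ?mul0r; [ring | rewrite /= in_itv/= ltNge xt].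
rewrite max_l; last by rewrite subr_ge0 ltW.
move: t1; rewrite le_eqVlt => /predU1P[->|t1].
  by rewrite memNset /psi; [field | rewrite /= in_itv/= ltxx andbF].
rewrite mem_set/=; last by rewrite in_itv/= xt.
by rewrite /psi; field.
Qed.

End Fixed.

(** The difference factors through [3 - x^2 - x y - y^2], which is positive on the open square. *)
Lemma cubic_inj (x y : R) : -1 < x < 1 -> -1 < y < 1 ->
  2 - 3 * x + x ^+ 3 = 2 - 3 * y + y ^+ 3 -> x = y.
Proof.
move=> /andP[? ?] /andP[? ?] h; apply/eqP; rewrite -subr_eq0; apply/eqP.
have : (x - y) * (3 - x ^+ 2 - x * y - y ^+ 2) = 0 by lra.
move/eqP; rewrite mulf_eq0 => /orP[/eqP //|/eqP e]; nra.
Qed.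

Lemma xiE (xi0 : R) : -1 < xi0 < 1 -> xi ((1 - (3 * xi0 - xi0 ^+ 3) / 2) / 3) = xi0.
Proof.
move=> x1; rewrite /xi.
have e : (1 - (3 * xi0 - xi0 ^+ 3) / 2) / 3 = (2 - 3 * xi0 + xi0 ^+ 3) / 6 by field.
set S := [set x | _]; have Sx : S xi0 by split; [rewrite /D /= in_itv | rewrite varphiE].
have [] : S (get S) by apply: getPex; exists xi0.
rewrite /D /= in_itv/= => gI; rewrite varphiE// e => h.
by apply: cubic_inj => //; lra.
Qed.

Lemma xi_exists (lam : R) : -1 < lam < 1 ->
  exists2 xi0 : R, -1 < xi0 < 1 & lam = (3 * xi0 - xi0 ^+ 3) / 2.
Proof.
move=> /andP[l0 l1]; pose q (x : R) := (3 * x - x ^+ 3) / 2.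
have cq : continuous q.
  move=> x; apply: cvgMl; apply: cvgB; first by apply: cvgMr; exact: cvg_id.
  exact: exprn_continuous.
have [|||c cI qc] := @IVT R q (-1) 1 lam; [lra|exact: continuous_subspaceT| |].
  have -> : q (-1) = -1 by rewrite /q; field.
  have -> : q 1 = 1 by rewrite /q; field.
  by rewrite ge_min le_max (ltW l0) (ltW l1) orbT.
exists c; last by rewrite -qc.
move: cI; rewrite in_itv/= => /andP[c0 c1]; apply/andP; split.
  rewrite lt_neqAle c0 andbT; apply/eqP => ce; move: qc; rewrite -ce /q; lra.
rewrite lt_neqAle c1 andbT; apply/eqP => ce; move: qc; rewrite ce /q; lra.
Qed.

Lemma oppr_image_itv (b : R) : -%R @` `]b, 1[%classic = `]-1, - b[%classic.
Proof.
apply/seteqP; split => x /=; rewrite in_itv/=.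
  by move=> [t]; rewrite in_itv/= => /andP[bt t1] <-; rewrite !ltrN2 bt t1.
by move=> /andP[h1 h2]; exists (- x); rewrite ?opprK// in_itv/= ltrNr h2 ltrNl h1.
Qed.

Lemma value_le (x : R) : -1 < x < 1 -> (1 - x ^+ 2) ^+ 3 / 12 <= 1 / 12.
Proof.
move=> /andP[? ?]; rewrite ler_pM2r ?invr_gt0//.
have h : 0 <= 1 - x ^+ 2 by nra.
by rewrite exprn_ile1//; have := sqr_ge0 x; lra.
Qed.

Lemma value_eq (x : R) : -1 < x < 1 -> (1 - x ^+ 2) ^+ 3 / 12 = 1 / 12 -> x = 0.
Proof.
move=> /andP[? ?] /(divIf _) => /(_ ltac:(by rewrite pnatr_eq0)) h.
have h0 : 0 <= 1 - x ^+ 2 by nra.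
have : 1 - x ^+ 2 = 1.
  by apply/eqP; rewrite -(eqrXn2 (n := 3))// h expr1n.
move=> e; apply/eqP; rewrite -sqrf_eq0; apply/eqP; lra.
Qed.

Lemma gammaE : gamma R = (1 / 12)%:E.
Proof.
apply/eqP; rewrite eq_le; apply/andP; split.
  apply: ge_ereal_sup => _ [lam [A [u [Dl fe <-]]]].
  have [|x x1 lE] := @xi_exists lam; first by rewrite /D /= in_itv in Dl.
  rewrite lE in fe; apply: le_trans (feasible_le x1 fe) _.
  by rewrite lee_fin; exact: value_le.
apply: ereal_sup_ubound.
have x1 : -1 < (0 : R) < 1 by rewrite ltrN10 ltr01.
have sgE : (1 : R) = 1 \/ (1 : R) = -1 by left.
have [u [fe ou]] :=
  half_feasible x1 sgE (half_open x1 sgE) (@half_sub _ _) (null_eq_refl (half _ 1)).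
(* The multiplier 0, written as the cubic at [xi = 0] so that the results for fixed [xi] apply. *)
exists ((3 * 0 - 0 ^+ 3) / 2), (half 0 1), u; split => //.
  by rewrite /D /= in_itv/=; apply/andP; split; lra.
by rewrite ou expr0n subr0 expr1n.
Qed.

Lemma optimalE A : open A -> A `<=` D R ->
  optimal A <-> null_eq A `]0, 1[%classic \/ null_eq A `]-1, 0[%classic.
Proof.
move=> oA AD.
have x1 : -1 < (0 : R) < 1 by rewrite ltrN10 ltr01.
split.
  move=> [lam [u [Dl fe]]]; rewrite gammaE => ou.
  have [|x xI lE] := @xi_exists lam; first by rewrite /D /= in_itv in Dl.
  rewrite lE in fe.
  have x0 : x = 0.
    apply: value_eq => //; apply/eqP; rewrite eq_le value_le//=.
    by have := feasible_le xI fe; rewrite ou lee_fin.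
  rewrite x0 in fe; have := feasible_eq x1 fe.
  by rewrite oppr0; apply; rewrite ou expr0n subr0 expr1n.
rewrite -[X in `]-1, X[%classic]oppr0 => /(optimal_atE x1 oA AD)[u fe].
rewrite gamma_atE// => ou; exists ((3 * 0 - 0 ^+ 3) / 2), u; split => //.
  by rewrite /D /= in_itv/=; apply/andP; split; lra.
by rewrite ou gammaE expr0n subr0 expr1n.
Qed.

End Development.

(* Two open sets are identified when they differ by a Lebesgue-null set: deleting
   a point from an optimal A leaves u_{A,lambda} and the objective unchanged. *)
Theorem theorem1p4 (R : realType) :
  (forall lambda : R, -1 < lambda < 1 ->
     forall A : set R, open A -> A `<=` D R ->
       (optimal_at lambda A <->
        null_eq A (endset ((1 - lambda) / 3)) \/
        null_eq A (-%R @` endset ((1 - lambda) / 3)))) /\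
  (forall A : set R, open A -> A `<=` D R ->
     (optimal A <->
      null_eq A `]0, 1[%classic \/ null_eq A `]-1, 0[%classic)) /\
  gamma R = (1 / 12)%:E.
Proof.
split; last by split; [exact: optimalE | exact: gammaE].
move=> lam lI A oA AD; have [x xI lE] := xi_exists lI.
rewrite lE /endset xiE// oppr_image_itv; exact: optimal_atE.
Qed.
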